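(* Let $\Delta$ be a $(d-1)$-dimensional flag complex with $\beta_{d-1}(\Delta) = a > 0$. If \[a = \binom{a_d}{d}_{\!d} + \binom{a_{d-1}}{d-1}_{\!d-1} + \dots + \binom{a_{d-s}}{d-s}_{\!d-s}\] is the $(d,d)$-canonical representation of $a$, then \[f_{i-1}(\Delta) \geq \binom{a_d+d}{i}_{\!d} + \binom{a_{d-1}+d-1}{i-1}_{\!d-1} + \dots + \binom{a_{d-s}+d-s}{i-s}_{\!d-s} \qquad (\ast)\] for all $i\geq 0$. Furthermore, if equality holds in $(\ast)$ for some $i=k$ with $k\geq s+1$, then equality holds in $(\ast)$ for all $i\geq k$.
   Context: A flag complex is a (finite, non-empty) simplicial complex in which every set of pairwise adjacent vertices is a face. $f_i(\Delta)$ is the number of $i$-dimensional faces ($f_{-1}=1$). Fix a field $\Bbbk$; $\beta_k(\Delta)=\dim_{\Bbbk}\widetilde{H}_k(\Delta;\Bbbk)$. The Turán graph $T_d(n)$ is the complete $d$-partite graph on $n$ vertices with parts of sizes $\lfloor n/d\rfloor$ or $\lceil n/d\rceil$ (for $n\le d$ it is $K_n$). $\binom{n}{k}_{\!d}$ denotes the number of $k$-cliques of $T_d(n)$ when $0\le k\le n$, and $\binom{n}{k}_{\!d}=0$ if $k>n$, $k<0$ or $n<0$. For positive integers $N,k,r$ with $r\ge k$ there are unique integers $s,N_k,\dots,N_{k-s}$ with $N=\sum_{i=0}^{s}\binom{N_{k-i}}{k-i}_{\!r-i}$, $N_{k-i}-\lfloor N_{k-i}/(r-i)\rfloor>N_{k-i-1}$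 for $0\le i<s$, and $N_{k-s}\ge k-s>0$: the $(k,r)$-canonical representation of $N$. *)

(* Defs.v *)
From mathcomp Require Import all_boot all_order all_algebra.

Set Implicit Arguments.
Unset Strict Implicit.
Unset Printing Implicit Defensive.

Import Order.TTheory GRing.Theory Num.Theory.
Local Open Scope ring_scope.

(** * Simplicial complexes *)

(* A complex is given by its set of faces over an ambient finite type [V]; its
   vertices are the [v] with [[set v] \in D], which need not be all of [V]. *)

Definition simplicial_complex (V : finType) (D : {set {set V}}) : bool :=
  (D != set0) && [forall F in D, forall G : {set V}, (G \subset F) ==> (G \in D)].

Definition flag_complex (V : finType) (D : {set {set V}}) : bool :=
  simplicial_complex D &&
  [forall S : {set V},
     [forall v in S, [set v] \in D] &&
     [forall u in S, forall v in S, (u != v) ==> ([set u; v] \in D)]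
     ==> (S \in D)].

(* An [i]-dimensional face has [i + 1] vertices; the empty face has dimension
   [-1], which is why dimensions are integers. *)
Definition faces (V : finType) (D : {set {set V}}) (i : int) : {set {set V}} :=
  [set F in D | #|F|%:Z == i + 1].

Definition face_number (V : finType) (D : {set {set V}}) (i : int) : nat :=
  #|faces D i|.

Definition dimension (V : finType) (D : {set {set V}}) : int :=
  (\max_(F in D) #|F|)%:Z - 1.

(** * Reduced simplicial homology *)

(* Vertices are oriented by the enumeration order of [V]: deleting [v] from the
   face [F] carries the sign [(-1) ^ p], [p] being the number of vertices of [F]
   that precede [v]. *)
Definition face_sign (K : fieldType) (V : finType) (F : {set V}) (v : V) : K :=
  (-1) ^+ #|[set u in F | (enum_rank u < enum_rank v)%N]|.

(* The coefficient of [G] in the boundary of [F]. *)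
Definition incidence (K : fieldType) (V : finType) (F G : {set V}) : K :=
  \sum_(v in F | F :\ v == G) face_sign K F v.

Definition incidence_mx (K : fieldType) (V : finType) (A B : {set {set V}}) :
    'M[K]_(#|A|, #|B|) :=
  \matrix_(i, j) incidence K (enum_val i) (enum_val j).

(* Chains are row vectors indexed by the faces, and the boundary map
   [C_k -> C_(k-1)] is right multiplication by
   [incidence_mx K (faces D k) (faces D (k - 1))]. The complex is augmented:
   [C_(-1)] is spanned by the empty face. *)
Definition cycles (K : fieldType) (V : finType) (D : {set {set V}}) (k : int) :
    'M[K]_#|faces D k| :=
  kermx (incidence_mx K (faces D k) (faces D (k - 1))).

Definition boundaries (K : fieldType) (V : finType) (D : {set {set V}}) (k : int) :
    'M[K]_(#|faces D (k + 1)|, #|faces D k|) :=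
  incidence_mx K (faces D (k + 1)) (faces D k).

(* By [boundaries_sub_cycles] below, this is the dimension of the quotient of
   the [k]-cycles by the [k]-boundaries. *)
Definition betti (K : fieldType) (V : finType) (D : {set {set V}}) (k : int) : nat :=
  (\rank (cycles K D k) - \rank (boundaries K D k))%N.

Lemma face_sign_swap (K : fieldType) (V : finType) (F : {set V}) (v w : V) :
  v \in F -> w \in F -> (enum_rank v < enum_rank w)%N ->
  face_sign K F v * face_sign K (F :\ v) w =
  - (face_sign K F w * face_sign K (F :\ w) v).
Proof.
move=> vF wF ltvw; rewrite /face_sign.
have -> : [set u in F :\ w | (enum_rank u < enum_rank v)%N] =
          [set u in F | (enum_rank u < enum_rank v)%N].
  apply/setP=> u; rewrite !inE; case: eqP => //= ->.
  by rewrite ltnNge (ltnW ltvw) andbF.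
rewrite [in RHS](cardsD1 v) !inE vF ltvw /=.
have -> : [set u in F | (enum_rank u < enum_rank w)%N] :\ v =
          [set u in F :\ v | (enum_rank u < enum_rank w)%N].
  by apply/setP=> u; rewrite !inE andbA.
by rewrite exprD expr1 mulN1r mulNr opprK mulrC.
Qed.

Lemma incidence_mx_comp (K : fieldType) (V : finType) (D : {set {set V}}) (k : int) :
  simplicial_complex D ->
  incidence_mx K (faces D (k + 1)) (faces D k) *m
  incidence_mx K (faces D k) (faces D (k - 1)) = 0.
Proof.
case/andP=> _ /forall_inP closedD; apply/matrixP=> i j; rewrite !mxE.
under eq_bigr do rewrite !mxE.
set F := enum_val i; set H := enum_val j.
rewrite -(big_enum_val (fun G => incidence K F G * incidence K G H)).
have := enum_valP i; rewrite -/F inE => /andP[FD /eqP cF].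
have delF v : v \in F -> F :\ v \in faces D k.
  move=> vF; rewrite inE; apply/andP; split.
    by have /forallP/(_ (F :\ v))/implyP := closedD _ FD; apply; rewrite subD1set.
  by move: cF; rewrite (cardsD1 v) vF add1n -addn1 PoszD => /addIr ->.
pose t v w := (face_sign K F v * face_sign K (F :\ v) w) *+
  [&& v \in F, w \in F & (F :\ v) :\ w == H].
have -> : \sum_(G in faces D k) incidence K F G * incidence K G H =
          \sum_v \sum_(w | w != v) t v w.
  under eq_bigr do rewrite mulr_suml big_mkcondr /=.
  rewrite exchange_big /= [RHS](bigID (mem F)) /= [X in _ = _ + X]big1 ?addr0.
    apply: eq_bigr => v vF; rewrite (bigD1 (F :\ v)) ?delF //= eqxx.
    rewrite [X in _ + X]big1 ?addr0 => [|G /andP[_ /negPf]]; last first.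
      by rewrite eq_sym => ->.
    rewrite mulr_sumr big_mkcond [RHS]big_mkcond; apply: eq_bigr => w _.
    rewrite /t vF !inE /=.
    by case: (w != v) => //=; case: (w \in F) => //=; case: (_ == H).
  by move=> v /negPf vF; apply: big1 => w _; rewrite /t vF.
pose lt (v w : V) := (enum_rank v < enum_rank w)%N.
have -> : \sum_v \sum_(w | w != v) t v w =
          \sum_v \sum_(w | lt v w) t v w + \sum_v \sum_(w | lt w v) t v w.
  rewrite -big_split; apply: eq_bigr => v _ /=.
  rewrite (bigID (lt v)) /=; congr (_ + _); apply: eq_bigl => w; rewrite /lt.
    by apply: andb_idl => ltvw; apply: contraTneq ltvw => ->; rewrite ltnn.
  rewrite -leqNgt ltn_neqAle; congr (~~ _ && _).
  by rewrite -(inj_eq enum_rank_inj) -val_eqE.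
rewrite [X in _ + X](exchange_big_dep xpredT) //= -big_split big1 //= => v _.
rewrite -big_split big1 //= => w ltvw; rewrite /t.
have -> : (F :\ w) :\ v = (F :\ v) :\ w by apply/setP=> u; rewrite !inE andbCA.
case vF: (v \in F); case wF: (w \in F); rewrite ?addr0 //=.
by rewrite (face_sign_swap K vF wF ltvw) mulNrn addNr.
Qed.

Lemma boundaries_sub_cycles (K : fieldType) (V : finType) (D : {set {set V}}) (k : int) :
  simplicial_complex D -> (boundaries K D k <= cycles K D k)%MS.
Proof. by move=> sD; apply/sub_kermxP; apply: incidence_mx_comp. Qed.

(** * Turan graphs and canonical representations *)

Definition clique (T : finType) (e : rel T) (S : {set T}) : bool :=
  [forall x in S, forall y in S, (x != y) ==> e x y].

(* The parts are the residue classes modulo [d], which for [0 < d] are [d]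
   classes of size [n %/ d] or [n %/ d + 1]; the case [d = 0] is never used. *)
Definition turan_graph (d n : nat) : rel 'I_n :=
  fun x y => (x %% d != y %% d)%N.

Definition turan_cliques (d n k : nat) : nat :=
  #|[set S : {set 'I_n} | (#|S| == k) && clique (@turan_graph d n) S]|.

Definition turan_binomial (d : nat) (n k : int) : nat :=
  if (0 <= k) && (k <= n) then turan_cliques d `|n|%N `|k|%N else 0%N.

(* [c j] is the entry written [N_j], so only [c k, ..., c (k - s)] matter. As
   [s < k <= r], none of the natural number subtractions truncates. *)
Definition canonical_representation (k r N s : nat) (c : nat -> int) : Prop :=
  [/\ [/\ (0 < N)%N, (0 < k)%N & (k <= r)%N],
      N = (\sum_(i < s.+1) turan_binomial (r - i) (c (k - i)%N) (k - i)%N%:Z)%N,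
      forall i : nat, (i < s)%N ->
        c (k - i)%N - (c (k - i)%N %/ (r - i)%N%:Z)%Z > c (k - i - 1)%N,
      c (k - s)%N >= (k - s)%N%:Z
    & (s < k)%N].

(* The right-hand side of the lower bound on [f_(i-1)]: the entries [c j] of the
   [(d, d)]-canonical representation are shifted to [c j + j], and the lower
   indices run through [i, i - 1, ..., i - s], possibly negative. *)
Definition shifted_sum (d s : nat) (c : nat -> int) (i : int) : nat :=
  (\sum_(j < s.+1)
     turan_binomial (d - j) (c (d - j)%N + (d - j)%N%:Z) (i - j%:Z))%N.

(* Main.v *)
Require Import Defs.
From mathcomp Require Import all_boot all_order all_algebra.
From mathcomp Require Import zify.

(* Idea. View the complex as the clique complex of a graph, and let [S] be a set
   of vertices without [(r+1)]-cliques and with [a] independent [r]-cycles. Choose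
   [v] in [S] whose link has the largest number [b] of independent [(r-1)]-cycles,
   and delete the non-neighbours of [v] one at a time. Each deletion of a vertex
   [w] loses at most [b_w <= b] cycles, [b_w] being computed in the link of [w],
   and the cone that remains has none; so the [b_w] add up to at least [a].
   By induction the face numbers of the links dominate the numbers
   [\sum_k 'C(r-1-k, i-k) g_k], where [g_k] counts the [k]-sets in the shadow of
   the first [b_w] rainbow [(r-1)]-sets in colexicographic order. Gluing these
   initial segments to the vertices of one more colour gives a coloured family
   with at least [a] members, and the coloured Kruskal-Katona theorem of Frankl,
   Furedi and Kalai compares its shadow with that of an initial segment.

   For the equality statement the same deletion, with cliques in place of cycles,
   shows that the clique numbers of a graph obey the coloured Kruskal-Katona
   bound; one [(k+1)]-clique too many would force too many [k]-cliques.

   The coloured Kruskal-Katona theorem is proved by compression: replace the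
   deletion and the links of one colour by initial segments. A family that cannot
   be compressed any further is an initial segment or admits an exchange that
   decreases its total code without enlarging its shadow. *)

(** The binomial weights come from cones: the cone over the link of [v] has as [i]-cliques those of
    the link and, joined to [v], its [(i-1)]-cliques, so each round of deletions is one use of
    Pascal's rule. Summed against the shadow of a segment of canonical length, the weights turn
    every Turan count on [n] vertices into one on [n + r] vertices, which is the shift in the bound.
    The maximal choice of [v] matters because initial segments are nested: the shadows of all glued
    links lie in that of the largest one, and the link of [v] pays for it. In the coloured
    Kruskal-Katona theorem the obstacle is the case of as many colours as elements. Deleting a
    colour then leaves nothing, so compression controls links only, and a single exchange may
    enlarge the shadow; a whole fibre is moved instead. In the equality statement [k >= s + 1]
    leaves room for one further term of the representation, worth exactly one set of size [i + 1]
    and at least one of size [i]. *)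

Set Implicit Arguments.
Unset Strict Implicit.
Unset Printing Implicit Defensive.

(** * The colexicographic order and its initial segments *)

(* Comparing binary codes is comparing sets colexicographically. *)
Definition code (N : nat) (x : {set 'I_N}) : nat := \sum_(v in x) 2 ^ v.

Definition initial (N : nat) (U F : {set {set 'I_N}}) : Prop :=
  F \subset U /\
  forall x y, x \in U -> y \in F -> code x < code y -> x \in F.

(** Cutting by rank gives a segment for every [m]; past the size of [U] it is [U] itself. *)
Definition init (N : nat) (U : {set {set 'I_N}}) (m : nat) : {set {set 'I_N}} :=
  [set x in U | #|[set y in U | code y < code x]| < m].

Section Colex.

Variable N : nat.
Implicit Types (x y z : {set 'I_N}) (u v w : 'I_N) (U F G J : {set {set 'I_N}}).

Lemma codeD1 x v : v \in x -> code x = 2 ^ v + code (x :\ v).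
Proof. by move=> vx; rewrite /code (big_setD1 v). Qed.

Lemma codeU1 x v : v \notin x -> code (v |: x) = 2 ^ v + code x.
Proof. by move=> vx; rewrite /code big_setU1. Qed.

Lemma code_lt_exp m x : (forall v, v \in x -> v < m) -> code x < 2 ^ m.
Proof.
elim: m x => [|m IHm] x xm.
  by rewrite /code big1 // => v /xm.
case: (pickP [pred v in x | v == m :> nat]) => [v /andP[vx /eqP vm]|no].
  rewrite (codeD1 vx) vm expnS mul2n -addnn ltn_add2l; apply: IHm => w.
  rewrite !inE => /andP[wv /xm]; rewrite ltnS leq_eqVlt => /orP[/eqP wm|//].
  by case/eqP: wv; apply: val_inj; rewrite /= wm vm.
apply: leq_trans (IHm x _) _; last by rewrite leq_exp2l.
move=> v vx; have := xm v vx; rewrite ltnS leq_eqVlt => /orP[vm|//].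
by have := no v; rewrite /= vx vm.
Qed.

Lemma code_ge_exp x v : v \in x -> 2 ^ v <= code x.
Proof. by move=> vx; rewrite (codeD1 vx) leq_addr. Qed.

Lemma codeID x y : code x = code (x :&: y) + code (x :\: y).
Proof. by rewrite /code (big_setID y). Qed.

(** The vertices of [x] outside [y] contribute less than [2 ^ w] in all. *)
Lemma code_lt x y w : w \in y -> w \notin x ->
  (forall v, v \in x -> v \notin y -> v < w) -> code x < code y.
Proof.
move=> wy wx xw; rewrite (codeID x y) (codeID y x) setIC ltn_add2l.
apply: leq_trans (code_lt_exp (m := w) _) _.
  by move=> v; rewrite !inE => /andP[vy vx]; apply: xw.
by apply: code_ge_exp; rewrite !inE wx.
Qed.

Lemma code_cmp x y : x != y ->
  exists w, [/\ w \in (x :\: y) :|: (y :\: x) &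
    forall v, v \in (x :\: y) :|: (y :\: x) -> v <= w].
Proof.
move=> xy; set S := _ :|: _.
have [v0 v0S] : exists v, v \in S.
  apply/set0Pn; apply: contra xy => /eqP/setP S0; apply/eqP/setP => v.
  by have := S0 v; rewrite !inE; case: (v \in x); case: (v \in y).
by case: (arg_maxnP (fun v : 'I_N => val v) v0S) => w wS wmax; exists w.
Qed.

Lemma code_ltP x y : code x < code y ->
  exists w, [/\ w \in y, w \notin x & forall v, v \in x -> v \notin y -> v < w].
Proof.
move=> cxy; have xy : x != y by apply: contraTneq cxy => ->; rewrite ltnn.
have [w [wS wmax]] := code_cmp xy; exists w.
have lt v : v \in (x :\: y) :|: (y :\: x) -> v != w -> v < w.
  by move=> vS vw; rewrite ltn_neqAle wmax // andbT.
move: wS; rewrite !inE => /orP[]/andP[wy wx]; last first.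
  split=> // v vx vy; apply: lt; first by rewrite !inE vx vy.
  by apply: contraNneq vy => ->.
suff : code y < code x by rewrite ltnNge ltnW.
apply: (@code_lt _ _ w) => // v vy vx; apply: lt; first by rewrite !inE vx vy orbT.
by apply: contraNneq vx => ->.
Qed.

Lemma code_inj : injective (@code N).
Proof.
move=> x y cxy; apply/eqP; apply/negPn/negP => xy.
have [w [wS wmax]] := code_cmp xy.
have lt v : v \in (x :\: y) :|: (y :\: x) -> v != w -> v < w.
  by move=> vS vw; rewrite ltn_neqAle wmax // andbT.
move: wS; rewrite !inE => /orP[]/andP[wy wx].
  suff : code y < code x by rewrite cxy ltnn.
  apply: (@code_lt _ _ w) => // v vy vx; apply: lt; first by rewrite !inE vx vy orbT.
  by apply: contraNneq vx => ->.
suff : code x < code y by rewrite cxy ltnn.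
apply: (@code_lt _ _ w) => // v vx vy; apply: lt; first by rewrite !inE vx vy.
by apply: contraNneq vy => ->.
Qed.

Lemma code_total x y : x != y -> ~~ (code x < code y) -> code y < code x.
Proof.
by move=> xy; rewrite -leqNgt leq_eqVlt => /orP[/eqP/code_inj yx|//]; rewrite yx eqxx in xy.
Qed.

Lemma code_swap x w g : w \in x -> g \notin x -> g < w ->
  code (g |: (x :\ w)) < code x.
Proof.
move=> wx gx gw; rewrite (codeD1 wx) codeU1; last by rewrite !inE negb_and gx orbT.
by rewrite ltn_add2r ltn_exp2l.
Qed.

Lemma initial_nested U F G : initial U F -> initial U G -> #|F| <= #|G| -> F \subset G.
Proof.
move=> [FU iF] [GU iG] cFG; apply/negPn/negP => /subsetPn[x xF xG].
have sub : G \subset F :\ x.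
  apply/subsetP=> y yG; rewrite !inE; have yx : y != x by apply: contraNneq xG => <-.
  rewrite yx /=; apply: (iF _ x) => //; first exact: (subsetP GU).
  apply: code_total; first by rewrite eq_sym.
  by apply: contra xG; apply: iG => //; apply: (subsetP FU).
by move: cFG (subset_leq_card sub); rewrite (cardsD1 x F) xF add1n ltnNge => /negP.
Qed.

Lemma initial_exists U m : m <= #|U| -> exists2 J, initial U J & #|J| = m.
Proof.
elim: m => [_|m IHm mU].
  by exists set0; rewrite ?cards0 //; split; rewrite ?sub0set // => x y _; rewrite inE.
have [J [JU iJ] cJ] := IHm (ltnW mU).
have [x0 x0U] : exists x, x \in U :\: J.
  by apply/set0Pn; rewrite -card_gt0 cardsD (setIidPr JU) cJ subn_gt0.
case: (@arg_minnP _ x0 (mem (U :\: J)) (@code N) x0U) => x xUJ xmin.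
move: (xUJ); rewrite /= inE => /andP[xJ xU].
exists (x |: J); last by rewrite cardsU1 xJ cJ.
split; first by rewrite subUset sub1set xU.
move=> y z yU; rewrite !inE => /orP[/eqP->|zJ] yz; last by rewrite (iJ y z) ?orbT.
rewrite orbC; apply/orP; left; apply/negPn/negP => yJ.
by have := xmin y; rewrite !inE yJ yU leqNgt yz => /(_ isT).
Qed.

Lemma initialE U J : initial U J -> J = init U #|J|.
Proof.
move=> [JU iJ]; apply/setP=> x; rewrite inE.
case xU: (x \in U) => /=; last by apply: contraFF xU => /(subsetP JU).
case xJ: (x \in J).
  rewrite (cardsD1 x J) xJ ltnS; symmetry; apply: subset_leq_card.
  apply/subsetP=> y; rewrite !inE => /andP[yU yx]; rewrite (iJ y x) // andbT.
  by apply: contraTneq yx => ->; rewrite ltnn.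
symmetry; apply/negbTE; rewrite -leqNgt; apply: subset_leq_card.
apply/subsetP=> y yJ; rewrite inE (subsetP JU) //=; apply: code_total.
  by apply: contraFneq xJ => ->.
by apply: contraFN xJ; apply: iJ.
Qed.

Lemma init_initial U m : initial U (init U m).
Proof.
split; first by apply/subsetP=> x; rewrite inE => /andP[].
move=> x y xU; rewrite !inE xU => /andP[yU ym] xy /=; apply: leq_ltn_trans ym.
by apply/subset_leq_card/subsetP=> z; rewrite !inE => /andP[-> /ltn_trans->].
Qed.

Lemma init_sub U m : init U m \subset U.
Proof. by case: (init_initial U m). Qed.

Lemma card_init U m : m <= #|U| -> #|init U m| = m.
Proof. by case/initial_exists=> J /initialE JE cJ; rewrite -{1}cJ -JE. Qed.

Lemma card_init_le U m : #|init U m| <= m.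
Proof.
have [mU|/ltnW Um] := leqP m #|U|; first by rewrite card_init.
exact: leq_trans (subset_leq_card (init_sub U m)) Um.
Qed.

Lemma init_mono U m n : m <= n -> init U m \subset init U n.
Proof.
by move=> mn; apply/subsetP=> x; rewrite !inE => /andP[-> /leq_trans->].
Qed.

Lemma initial_sub_init U J m : initial U J -> #|J| <= m -> J \subset init U m.
Proof. by move=> iJ cJ; rewrite (initialE iJ); apply: init_mono. Qed.

(** Outside their intersection [F] and the segment have equally many members, and each one of the
    segment is smaller than each one of [F]. The equality case is what shows that a compression
    without gain found a segment already. *)
Lemma initial_sum U F : F \subset U ->
  \sum_(x in init U #|F|) code x <= \sum_(x in F) code x ?= iff (F == init U #|F|).
Proof.
move=> FU; set I := init U #|F|.
have [IU iI] : initial U I := init_initial U #|F|.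
have cI : #|I| = #|F| by rewrite card_init // subset_leq_card.
case: eqP => [<-|/eqP neFI]; first by split; rewrite ?eqxx.
suff lt : \sum_(x in I) code x < \sum_(x in F) code x.
  by split; [exact: ltnW | rewrite ltn_eqF].
rewrite (big_setID F) [X in _ < X](big_setID I) /= setIC ltn_add2l.
have cD : #|I :\: F| = #|F :\: I|.
  by apply/eqP; rewrite -(eqn_add2l #|I :&: F|) cardsID setIC cardsID cI.
have [x0 x0D] : exists x, x \in F :\: I.
  apply/set0Pn; rewrite -card_gt0 -cD card_gt0 setD_eq0.
  by apply: contra neFI => IF; rewrite eq_sym eqEcard IF cI leqnn.
case: (@arg_minnP _ x0 (mem (F :\: I)) (@code N) x0D) => t; rewrite /= inE => /andP[tI tF] tmin.
have lt x : x \in I :\: F -> code x < code t.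
  rewrite inE => /andP[xF xI]; apply: code_total; first by apply: contraNneq tI => ->.
  by apply: contra tI; apply: iI (subsetP FU t tF) xI.
have [x1 x1D] : exists x, x \in I :\: F.
  by apply/set0Pn; rewrite -card_gt0 cD card_gt0; apply/set0Pn; exists x0.
apply: (@leq_trans (#|F :\: I| * code t)); last first.
  by rewrite -sum_nat_const; apply: leq_sum.
rewrite -cD -sum_nat_const (big_setD1 x1) //= [X in _ < X](big_setD1 x1) //=.
apply: (@leq_trans (code t + \sum_(x in (I :\: F) :\ x1) code x)).
  by rewrite ltn_add2r lt.
by rewrite leq_add2l; apply: leq_sum => x /setD1P[_ /lt/ltnW].
Qed.

End Colex.

(** * Rainbow sets and their shadows *)

(* With this colouring the rainbow sets are the cliques of a Turan graph, and
   the [q.+1] smallest vertices carry each colour once. *)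
Definition color (N q : nat) (v : 'I_N) : 'I_q.+1 := Ordinal (ltn_pmod v (ltn0Sn q)).

Definition colors (N q : nat) (x : {set 'I_N}) : {set 'I_q.+1} := @color N q @: x.

Definition rainbow (N q : nat) (C : {set 'I_q.+1}) (K : nat) : {set {set 'I_N}} :=
  [set x : {set 'I_N} | [&& #|x| == K, #|colors q x| == #|x| & colors q x \subset C]].

Definition shadow (N k : nat) (F : {set {set 'I_N}}) : {set {set 'I_N}} :=
  [set T : {set 'I_N} | (#|T| == k) && [exists x in F, T \subset x]].

Definition del (N q : nat) (j : 'I_q.+1) (F : {set {set 'I_N}}) : {set {set 'I_N}} :=
  [set x in F | j \notin colors q x].

Definition lnk (V : finType) (v : V) (F : {set {set V}}) : {set {set V}} :=
  [set y : {set V} | (v \notin y) && (v |: y \in F)].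

Lemma card_lnk (V : finType) (v : V) (F : {set {set V}}) :
  #|F| = #|[set x in F | v \notin x]| + #|lnk v F|.
Proof.
have <- : #|[set v |: y | y in lnk v F]| = #|lnk v F|.
  apply: card_in_imset => y z; rewrite !inE => /andP[vy _] /andP[vz _] yz.
  by rewrite -(setU1K vy) yz setU1K.
rewrite -(cardsID [set x : {set V} | v \notin x] F); congr (_ + _).
  by apply: eq_card => x; rewrite !inE.
apply: eq_card => x; rewrite !inE negbK; apply/andP/imsetP => [[vx xF]|[y]].
  by exists (x :\ v); rewrite ?inE ?inE ?eqxx /= setD1K.
by rewrite inE => /andP[vy yF] ->; rewrite setU11.
Qed.

Lemma exists_superset (V : finType) (T x : {set V}) k : T \subset x -> #|T| <= k <= #|x| ->
  exists S : {set V}, [/\ T \subset S, S \subset x & #|S| = k].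
Proof.
move=> Tx; elim: k => [|k IHk] /andP[Tk kx].
  by exists T; split=> //; apply/eqP; rewrite -leqn0.
move: Tk; rewrite leq_eqVlt => /orP[/eqP Tk|]; first by exists T.
rewrite ltnS => Tk; have [|S [TS Sx cS]] := IHk _; first by rewrite Tk ltnW.
have [v] : exists v, v \in x :\: S.
  by apply/set0Pn; rewrite -card_gt0 cardsD (setIidPr Sx) cS subn_gt0.
rewrite inE => /andP[vS vx]; exists (v |: S); split.
- exact: subset_trans TS (subsetUr _ _).
- by rewrite subUset sub1set vx.
- by rewrite cardsU1 vS cS.
Qed.

(** Rebuilds a family from its deletion [I] and its links [X v] at the vertices of colour [j];
    [del_assemble] and [lnk_assemble] recover them. *)
Definition assemble (N q : nat) (C : {set 'I_q.+1}) (K : nat) (j : 'I_q.+1)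
    (I : {set {set 'I_N}}) (X : 'I_N -> {set {set 'I_N}}) : {set {set 'I_N}} :=
  [set x in rainbow N C K.+1 |
     (x \in I) || [exists v in x, (color q v == j) && (x :\ v \in X v)]].

Section Rainbow.

Variables N q : nat.
Local Notation color := (@color N q).
Local Notation colors := (@colors N q).
Local Notation rainbow := (@rainbow N q).
Implicit Types (x y z T : {set 'I_N}) (u v w g : 'I_N) (F G I J : {set {set 'I_N}}).
Implicit Types (X : 'I_N -> {set {set 'I_N}}).
Implicit Types (C : {set 'I_q.+1}) (i j : 'I_q.+1).

Lemma rainbowP C K x :
  reflect [/\ #|x| = K, {in x &, injective color} & {subset colors x <= C}]
          (x \in rainbow C K).
Proof.
rewrite inE; apply: (iffP and3P) => [[/eqP cx /imset_injP ix /subsetP xC]|[cx ix xC]] //.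
by split; [apply/eqP | apply/imset_injP | apply/subsetP].
Qed.

Lemma mem_colors v x : v \in x -> color v \in colors x.
Proof. exact: imset_f. Qed.

Lemma colorsP i x : reflect (exists2 v, v \in x & i = color v) (i \in colors x).
Proof. exact: imsetP. Qed.

Lemma colorsU1 v x : colors (v |: x) = color v |: colors x.
Proof. by rewrite /colors imsetU1. Qed.

Lemma colorsS x y : x \subset y -> colors x \subset colors y.
Proof. exact: imsetS. Qed.

Lemma card_colors C K x : x \in rainbow C K -> #|colors x| = K.
Proof. by rewrite inE => /and3P[/eqP cx /eqP -> _]. Qed.

Lemma rainbow_col C K x v : x \in rainbow C K -> v \in x -> color v \in C.
Proof. by case/rainbowP=> _ _ xC vx; apply: xC; apply: mem_colors. Qed.

Lemma rainbow_sub C K x T : x \in rainbow C K -> T \subset x -> T \in rainbow C #|T|.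
Proof.
case/rainbowP=> _ ix xC Tx; apply/rainbowP; split=> //.
  by move=> u v uT vT; apply: ix; apply: (subsetP Tx).
by move=> i iT; apply: xC; apply: (subsetP (colorsS Tx)).
Qed.

Lemma rainbow_colD1 C K x v : x \in rainbow C K -> v \in x -> color v \notin colors (x :\ v).
Proof.
case/rainbowP=> _ ix _ vx; apply/negP => /colorsP[w]; rewrite !inE => /andP[wv wx] vw.
by rewrite (ix v w) ?eqxx in wv.
Qed.

Lemma rainbowD1 C K x v : x \in rainbow C K.+1 -> v \in x ->
  x :\ v \in rainbow (C :\ color v) K.
Proof.
move=> xP vx; have cv := rainbow_colD1 xP vx.
have /rainbowP[c1 c2 c3] := rainbow_sub xP (subD1set x v).
case/rainbowP: xP => cx _ _; apply/rainbowP; split=> //.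
  by move: cx; rewrite (cardsD1 v) vx => -[].
by move=> i ix; rewrite !inE c3 // andbT; apply: contraNneq cv => <-.
Qed.

Lemma rainbowU1 C K y v : y \in rainbow C K -> color v \in C -> color v \notin colors y ->
  v |: y \in rainbow C K.+1.
Proof.
case/rainbowP=> cy iy yC vC vy.
have vny : v \notin y by apply: contra vy; apply: mem_colors.
apply/rainbowP; split; first by rewrite cardsU1 vny cy.
  move=> u w; rewrite !inE => /orP[/eqP->|uy] /orP[/eqP->|wy] // uw.
  - by rewrite uw mem_colors in vy.
  - by rewrite -uw mem_colors in vy.
  - exact: iy.
by move=> i; rewrite colorsU1 !inE => /orP[/eqP->|/yC].
Qed.

Lemma rainbowD1_notin C K y j : y \in rainbow (C :\ j) K -> j \notin colors y.
Proof. by case/rainbowP=> _ _ yC; apply/negP => /yC; rewrite !inE eqxx. Qed.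

Lemma rainbowDU1 C K y v : y \in rainbow (C :\ color v) K -> color v \in C ->
  v |: y \in rainbow C K.+1.
Proof.
move=> yP vC; apply: rainbowU1 => //; last exact: rainbowD1_notin yP.
case/rainbowP: yP => cy iy yC; apply/rainbowP; split=> // i /yC.
by rewrite inE => /andP[].
Qed.

Lemma rainbowD1_sub C K j : rainbow (C :\ j) K \subset rainbow C K.
Proof.
apply/subsetP=> y /rainbowP[cy iy yC]; apply/rainbowP; split=> // i /yC.
by rewrite inE => /andP[].
Qed.

Lemma rainbowD1_mem C K j x : x \in rainbow C K -> j \notin colors x ->
  x \in rainbow (C :\ j) K.
Proof.
case/rainbowP=> cx ix xC jx; apply/rainbowP; split=> // i ix'.
by rewrite !inE xC // andbT; apply: contraNneq jx => <-.
Qed.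

Lemma rainbow_swap C K x w g : x \in rainbow C K -> w \in x -> color g \in C ->
  color g \notin colors (x :\ w) -> g |: (x :\ w) \in rainbow C K.
Proof.
move=> xP wx gC gx; have := rainbow_sub xP (subD1set x w).
case: K xP => [|K] xP; first by case/rainbowP: xP => /eqP; rewrite cards_eq0 => /eqP x0; rewrite x0 inE in wx.
have -> : #|x :\ w| = K by case/rainbowP: xP; rewrite (cardsD1 w) wx => -[].
by move=> xwP; apply: rainbowU1.
Qed.

Lemma rainbow_le C K x : x \in rainbow C K -> K <= #|C|.
Proof.
move=> xP; rewrite -(card_colors xP); apply: subset_leq_card.
by case/rainbowP: xP => _ _ xC; apply/subsetP.
Qed.

Lemma shadowP k F T :
  reflect (#|T| = k /\ exists2 x, x \in F & T \subset x) (T \in shadow k F).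
Proof.
rewrite inE; apply: (iffP andP) => [[/eqP cT /existsP[x /andP[xF Tx]]]|[cT [x xF Tx]]].
  by split=> //; exists x.
by split; [apply/eqP | apply/existsP; exists x; rewrite xF].
Qed.

Lemma shadowS k F G : F \subset G -> shadow k F \subset shadow k G.
Proof.
move=> FG; apply/subsetP=> T /shadowP[cT [x xF Tx]]; apply/shadowP; split=> //.
by exists x => //; apply: (subsetP FG).
Qed.

Lemma shadowU k F G : shadow k (F :|: G) = shadow k F :|: shadow k G.
Proof.
apply/eqP; rewrite eqEsubset; apply/andP; split; last first.
  by rewrite subUset !shadowS ?subsetUl ?subsetUr.
apply/subsetP=> T /shadowP[cT [x]]; rewrite inE => /orP[] xF Tx; rewrite inE.
  by apply/orP; left; apply/shadowP; split=> //; exists x.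
by apply/orP; right; apply/shadowP; split=> //; exists x.
Qed.

Lemma shadow_rainbow C K k F : F \subset rainbow C K -> shadow k F \subset rainbow C k.
Proof.
move=> FP; apply/subsetP=> T /shadowP[<- [x xF Tx]].
by apply: rainbow_sub Tx; apply: (subsetP FP) xF.
Qed.

Lemma shadow_id C K F : F \subset rainbow C K -> shadow K F = F.
Proof.
move=> FP; apply/setP=> T; apply/shadowP/idP => [[cT [x xF Tx]]|TF].
  suff /eqP-> : T == x by [].
  rewrite eqEcard Tx cT; have /rainbowP[-> _ _] := subsetP FP x xF.
  exact: leqnn.
by split; [have /rainbowP[] := subsetP FP T TF | exists T].
Qed.

Lemma shadow_gt C K k F : F \subset rainbow C K -> K < k -> shadow k F = set0.
Proof.
move=> FP Kk; apply/setP=> T; rewrite [RHS]inE; apply/shadowP => -[cT [x xF Tx]].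
have /rainbowP[cx _ _] := subsetP FP x xF.
by have := subset_leq_card Tx; rewrite cT cx leqNgt Kk.
Qed.

Lemma shadow0 F : #|shadow 0 F| = (F != set0).
Proof.
case: (set_0Vmem F) => [->|[x xF]].
  by rewrite eqxx; apply: eq_card0 => T; apply/shadowP => -[_ [x]]; rewrite inE.
have -> : F != set0 by apply/set0Pn; exists x.
rewrite (@eq_card1 _ set0) // => T; rewrite [RHS]inE; apply/shadowP/eqP => [[/eqP]|->].
  by rewrite cards_eq0 => /eqP.
by rewrite cards0; split=> //; exists x; rewrite ?sub0set.
Qed.

Lemma shadow_shadow C K k l F : F \subset rainbow C K -> l <= k <= K ->
  shadow l (shadow k F) = shadow l F.
Proof.
move=> FP lkK; apply/setP=> T; apply/shadowP/shadowP => -[cT [x]].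
  by case/shadowP=> _ [z zF xz] Tx; split=> //; exists z => //; apply: subset_trans xz.
move=> xF Tx; split=> //; have /rainbowP[cx _ _] := subsetP FP x xF.
have [|S [TS Sx cS]] := @exists_superset _ T x k Tx; first by rewrite cT cx.
by exists S => //; apply/shadowP; split=> //; exists x.
Qed.

Lemma lnk_rainbow C K F v : F \subset rainbow C K.+1 ->
  lnk v F \subset rainbow (C :\ color v) K.
Proof.
move=> FP; apply/subsetP=> y; rewrite inE => /andP[vy /(subsetP FP) yP].
by have := rainbowD1 yP (setU11 v y); rewrite setU1K.
Qed.

Lemma del_rainbow C K F j : F \subset rainbow C K -> del j F \subset rainbow (C :\ j) K.
Proof.
by move=> FP; apply/subsetP=> y; rewrite inE => /andP[/(subsetP FP)]; apply: rainbowD1_mem.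
Qed.

Lemma sum_del_lnk C K F j (f : {set 'I_N} -> nat) : F \subset rainbow C K ->
  \sum_(x in F) f x =
  \sum_(x in del j F) f x + \sum_(v | color v == j) \sum_(y in lnk v F) f (v |: y).
Proof.
move=> FP; rewrite (bigID (fun x => j \in colors x)) /= addnC; congr (_ + _).
  by apply: eq_bigl => x; rewrite inE.
transitivity (\sum_(x in F) \sum_(v | (color v == j) && (v \in x)) f x).
  rewrite big_mkcondr /=; apply: eq_bigr => x xF.
  have [_ ix _] := rainbowP _ _ _ (subsetP FP x xF).
  case: colorsP => [[v vx ->]|no].
    rewrite (big_pred1 v) // => w /=; apply/andP/eqP => [[/eqP wv wx]|->//].
    exact: ix.
  by rewrite big1 // => v /andP[/eqP vj vx]; case: no; exists v.
rewrite (exchange_big_dep (fun v => color v == j)) /=; last by move=> x v _ /andP[].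
apply: eq_bigr => v /eqP vj.
rewrite (reindex_onto (fun y => v |: y) (fun x => x :\ v)) /=; last first.
  by move=> x /andP[_ /andP[_ vx]]; rewrite setD1K.
apply: eq_bigl => y; rewrite !inE vj !eqxx /= andbT andbC.
case vy: (v \in y) => /=; last by rewrite setU1K ?vy // eqxx.
by apply/negbTE; rewrite negb_and; apply/orP; left; apply/eqP => /setP/(_ v); rewrite !inE eqxx vy.
Qed.

Lemma card_del_lnk C K F j : F \subset rainbow C K ->
  #|F| = #|del j F| + \sum_(v | color v == j) #|lnk v F|.
Proof.
move=> FP; rewrite -sum1_card (sum_del_lnk j _ FP) sum1_card; congr (_ + _).
by apply: eq_bigr => v _; rewrite sum1_card.
Qed.

Lemma lnk_shadow k F v : lnk v (shadow k.+1 F) = shadow k (lnk v F).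
Proof.
apply/setP=> T; rewrite inE; apply/andP/shadowP => [[vT /shadowP[]]|[cT [y]]].
  rewrite cardsU1 vT => -[cT] [x xF Tx]; split=> //.
  have vx : v \in x by apply: (subsetP Tx); rewrite setU11.
  exists (x :\ v); first by rewrite inE !inE eqxx /= setD1K.
  by rewrite subsetD1 vT andbT; apply: subset_trans Tx; apply: subsetUr.
rewrite inE => /andP[vy yF] Ty; have vT : v \notin T by apply: contra vy; apply/subsetP.
by split=> //; apply/shadowP; rewrite cardsU1 vT cT; split=> //; exists (v |: y) => //; apply: setUS.
Qed.

Lemma del_shadow C K k F j : F \subset rainbow C K.+1 ->
  del j (shadow k F) =
  shadow k (del j F) :|: \bigcup_(v | color v == j) shadow k (lnk v F).
Proof.
move=> FP; apply/setP=> T; rewrite in_setU [T \in del _ _]in_set.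
apply/andP/orP => [[/shadowP[cT [x xF Tx]] jT]|].
  have [jx|jx] := boolP (j \in colors x); last first.
    by left; apply/(@shadowP k); split=> //; exists x; rewrite // inE xF.
  case/colorsP: jx => v vx jv; right; apply/bigcupP; exists v; first by rewrite jv.
  have vT : v \notin T by apply: contra jT => vT; rewrite jv mem_colors.
  apply/shadowP; split=> //; exists (x :\ v); last by rewrite subsetD1 Tx.
  by rewrite inE !inE eqxx /= setD1K.
case=> [/(@shadowP k)[cT [x]]|/bigcupP[v /eqP vj] /shadowP[cT [y]]].
  rewrite inE => /andP[xF jx] Tx; split; first by apply/shadowP; split=> //; exists x.
  by apply: contra jx; apply/subsetP/colorsS.
move=> yF Ty; have /subsetP/(_ y yF) yP := lnk_rainbow v FP.
split; last first.
  have := rainbowD1_notin yP; rewrite vj; apply: contra; exact/subsetP/colorsS.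
apply/shadowP; split=> //; move: yF; rewrite inE => /andP[_ yF]; exists (v |: y) => //.
exact: subset_trans Ty (subsetUr _ _).
Qed.

Lemma assemble_rainbow C K j I X : assemble C K j I X \subset rainbow C K.+1.
Proof. by apply/subsetP=> x; rewrite inE => /andP[]. Qed.

Lemma del_assemble C K j I X : I \subset rainbow (C :\ j) K.+1 ->
  del j (assemble C K j I X) = I.
Proof.
move=> IP; apply/setP=> x; rewrite inE [x \in assemble _ _ _ _ _]inE.
apply/idP/idP => [/andP[/andP[xP /orP[//|/existsP[v /and3P[vx /eqP vj _]]]]]|xI].
  by rewrite -vj mem_colors.
have xP := subsetP IP x xI; rewrite xI (rainbowD1_notin xP) (subsetP (rainbowD1_sub _ _ _) x xP).
by [].
Qed.

Lemma lnk_assemble C K j I X v : j \in C -> I \subset rainbow (C :\ j) K.+1 ->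
  color v = j -> X v \subset rainbow (C :\ j) K -> lnk v (assemble C K j I X) = X v.
Proof.
move=> jC IP vj XP; apply/setP=> y; rewrite inE [_ \in assemble _ _ _ _ _]inE.
apply/and3P/idP => [[vy yP]|yX].
  have [_ iy _] := rainbowP _ _ _ yP.
  case/orP=> [/(subsetP IP)/rainbowD1_notin|/existsP[w /and3P[wy /eqP wj]]].
    by rewrite -vj mem_colors // setU11.
  suff -> : w = v by rewrite setU1K.
  by apply: iy; rewrite ?setU11 // vj.
have yP := subsetP XP y yX; have jy := rainbowD1_notin yP.
have vy : v \notin y by apply: contra jy => vy; rewrite -vj mem_colors.
split=> //; first by apply: rainbowDU1; rewrite ?vj.
by apply/orP; right; apply/existsP; exists v; rewrite setU11 vj eqxx setU1K.
Qed.

Hypothesis qN : q < N.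

Definition low i : 'I_N := Ordinal (leq_trans (ltn_ord i) qN).

Lemma col_low i : color (low i) = i.
Proof. by apply: val_inj; rewrite /= modn_small. Qed.

Lemma low_le v : low (color v) <= v.
Proof. exact: leq_mod. Qed.

Lemma low_lt i : low i < q.+1.
Proof. exact: (ltn_ord i). Qed.

Lemma lowE v : v < q.+1 -> low (color v) = v.
Proof. by move=> vq; apply: val_inj; rewrite /= modn_small. Qed.

Lemma col_inj_low u v : u < q.+1 -> v < q.+1 -> color u = color v -> u = v.
Proof. by move=> uq vq uv; rewrite -(lowE uq) uv lowE. Qed.

(** A set [T'] preceding the member [T] of the shadow is completed by the least vertex [u'] whose
    colour it lacks. The result does not come after the set [x] of [J] above [T], so it lies in
    [J]. *)
Lemma shadow_initial C K J : initial (rainbow C K.+1) J ->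
  initial (rainbow C K) (shadow K J).
Proof.
move=> [JP iJ]; split; first exact: shadow_rainbow JP.
move=> T' T T'P /shadowP[cT [x xJ Tx]] T'T.
have xP := subsetP JP x xJ; have [cx ix xC] := rainbowP _ _ _ xP.
have [cT' iT' T'C] := rainbowP _ _ _ T'P.
have [c0] : exists c, c \in C :\: colors T'.
  apply/set0Pn; rewrite -card_gt0 cardsD; have := rainbow_le xP.
  have : #|C :&: colors T'| <= K by rewrite -(card_colors T'P) subset_leq_card // subsetIr.
  lia.
rewrite inE => /andP[c0T' c0C].
pose A := [pred u | color u \in C :\: colors T'].
have A0 : A (low c0) by rewrite /A /= col_low inE c0T'.
case: (@arg_minnP _ (low c0) A (fun u : 'I_N => val u) A0) => u' /=.
rewrite inE => /andP[u'T' u'C] umin.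
have below g : g < u' -> color g \in C -> color g \in colors T'.
  move=> gu gC; apply/negPn/negP => gT'; have := umin g.
  by rewrite inE gT' gC leqNgt gu => /(_ isT).
have u'q : u' < q.+1.
  by apply: leq_ltn_trans (low_lt (color u')); apply: umin; rewrite col_low inE u'T'.
have u'n : u' \notin T' by apply: contra u'T'; apply: mem_colors.
suff zJ : u' |: T' \in J by apply/shadowP; split=> //; exists (u' |: T'); rewrite ?subsetUr.
have zP : u' |: T' \in rainbow C K.+1 by apply: rainbowU1.
have [cz iz _] := rainbowP _ _ _ zP.
have [->//|zx] := eqVneq (u' |: T') x.
apply: (iJ _ x) => //; apply: code_total; first by rewrite eq_sym.
apply/negP => xz.
have [E [Ez Ex Emax]] := code_ltP xz.
have [d [dT dT' dmax]] := code_ltP T'T.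
have T'x v : v \in T' -> v \notin x -> v < d.
  by move=> vT' vx; apply: dmax => //; apply: contra vx; apply/subsetP.
have xd : d \in x by apply: (subsetP Tx).
(* two vertices of one colour, the first below [u'] and hence low *)
have clash (h h' : 'I_N) : h < u' -> h \in x -> h' \in T' -> h \notin T' -> color h = color h' -> d <= u' -> False.
  move=> hu hx h'T' hT' hh' du.
  have neq : h' != h by apply: contraNneq hT' => <-.
  have h'x : h' \notin x by apply: contra neq => h'x; apply/eqP/ix => //.
  have h'q : h' < q.+1 by apply: ltn_trans (T'x _ h'T' h'x) _; apply: leq_ltn_trans u'q.
  by case/eqP: neq; apply: col_inj_low => //; apply: ltn_trans u'q.
(* [d] decides that [T'] precedes [T], and [E] would decide that [x] precedes [u' |: T']. Either way
   some vertex of [x] below [u'] has its colour repeated in [T'] on another low vertex. *)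
have [du|du] := eqVneq d u'; last first.
  have dE : d < E by apply: Emax => //; rewrite !inE negb_or du.
  have Eu : E = u'.
    move: Ez; rewrite !inE => /orP[/eqP//|ET'].
    by have := T'x E ET' Ex; rewrite ltnNge ltnW.
  rewrite Eu in dE; have /colorsP[d' d'T' dd'] := below d dE (rainbow_col xP xd).
  exact: (clash d d' dE xd d'T' dT' dd' (ltnW dE)).
have ET' : E \in T'.
  by move: Ez; rewrite !inE => /orP[/eqP Eu|//]; rewrite -du in Eu; rewrite Eu xd in Ex.
have Ed := T'x E ET' Ex.
have [h] : exists h, h \in x :\: (u' |: T').
  apply/set0Pn; rewrite setD_eq0; apply: contra zx => xz'.
  by rewrite eq_sym eqEcard xz' cz cx leqnn.
rewrite inE => /andP[hz hx]; have hE := Emax h hx hz.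
have hu : h < u' by rewrite -du; apply: ltn_trans Ed.
have /colorsP[h' h'T' hh'] := below h hu (rainbow_col xP hx).
apply: (clash h h') => //; last by rewrite du.
by apply: contra hz; rewrite !inE orbC => ->.
Qed.

End Rainbow.

(** * The coloured Kruskal-Katona theorem *)

Definition shadow_minimal (N q : nat) (C : {set 'I_q.+1}) : Prop :=
  forall K (F J : {set {set 'I_N}}), F \subset rainbow N C K.+1 ->
    initial (rainbow N C K.+1) J -> #|J| <= #|F| -> #|shadow K J| <= #|shadow K F|.

Definition improves (N q : nat) (C : {set 'I_q.+1}) (K : nat) (F F' : {set {set 'I_N}}) : Prop :=
  [/\ F' \subset rainbow N C K.+1, #|F'| = #|F|, #|shadow K F'| <= #|shadow K F|
    & \sum_(x in F') code x < \sum_(x in F) code x].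

(* What survives when all deletions and links of [F] are initial segments. *)
Definition compressed (N q : nat) (C : {set 'I_q.+1}) (K : nat) (F : {set {set 'I_N}}) : Prop :=
  forall x y, x \in rainbow N C K -> x \notin F -> y \in F -> code x < code y ->
    (forall v, v \in x -> v \notin y) /\
    (forall i, i \in C -> i \notin colors q x -> i \in colors q y).

(** * Compression along one colour *)

Section Compression.

Variables N q : nat.
Hypothesis qN : q < N.
Local Notation color := (@color N q).
Local Notation colors := (@colors N q).
Local Notation rainbow := (@rainbow N q).
Implicit Types (x y z T : {set 'I_N}) (u v w g : 'I_N) (F G I J : {set {set 'I_N}}).
Implicit Types (C : {set 'I_q.+1}) (i j : 'I_q.+1).

Definition compress C K j F : {set {set 'I_N}} :=
  assemble C K.+1 j (init (rainbow (C :\ j) K.+2) #|del j F|)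
    (fun v => init (rainbow (C :\ j) K.+1) #|lnk v F|).

Lemma del_compress C K j F : del j (compress C K j F) = init (rainbow (C :\ j) K.+2) #|del j F|.
Proof. by rewrite del_assemble // init_sub. Qed.

Lemma lnk_compress C K j F v : j \in C -> color v = j ->
  lnk v (compress C K j F) = init (rainbow (C :\ j) K.+1) #|lnk v F|.
Proof. by move=> jC vj; rewrite lnk_assemble ?init_sub. Qed.

Lemma card_bigcup_initial (S : finType) (Q : pred S) (X : S -> {set {set 'I_N}}) U m :
  (forall s, Q s -> initial U (X s)) -> (forall s, Q s -> #|X s| <= m) ->
  \bigcup_(s | Q s) X s \subset init U m.
Proof. by move=> iX cX; apply/bigcupsP => s Qs; apply: initial_sub_init; auto. Qed.

(** For the links the claim is the hypothesis on [C :\ j]. In the part of the shadow without colour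
    [j] all contributions of the compressed family are segments, hence nested, so their union is no
    larger than the largest; each of them is bounded by its counterpart for [F]. *)
Lemma compress_shadow C K j F : j \in C -> shadow_minimal N (C :\ j) ->
  F \subset rainbow C K.+2 ->
  [/\ #|compress C K j F| = #|F| & #|shadow K.+1 (compress C K j F)| <= #|shadow K.+1 F|].
Proof.
move=> jC FFK FP; set F' := compress C K j F.
have F'P : F' \subset rainbow C K.+2 := assemble_rainbow _ _ _ _ _.
have dP := del_rainbow j FP.
have lP v : color v = j -> lnk v F \subset rainbow (C :\ j) K.+1.
  by move=> vj; have := lnk_rainbow v FP; rewrite vj.
have cd : #|del j F'| = #|del j F|.
  by rewrite del_compress card_init // subset_leq_card.
have cl v : color v = j -> #|lnk v F'| = #|lnk v F|.
  by move=> vj; rewrite lnk_compress // card_init // subset_leq_card // lP.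
split.
  rewrite (card_del_lnk j F'P) (card_del_lnk j FP) cd; congr (_ + _).
  by apply: eq_bigr => v /eqP/cl.
rewrite (card_del_lnk j (shadow_rainbow K.+1 F'P)) (card_del_lnk j (shadow_rainbow K.+1 FP)).
apply: leq_add; last first.
  apply: leq_sum => v /eqP vj; rewrite !lnk_shadow; apply: FFK; rewrite ?lP ?cl //.
  by rewrite lnk_compress //; apply: init_initial.
apply: leq_trans (card_init_le (rainbow (C :\ j) K.+1) _).
apply: subset_leq_card; rewrite (del_shadow _ _ F'P) subUset; apply/andP; split.
  apply: initial_sub_init.
    by rewrite del_compress; apply: shadow_initial => //; apply: init_initial.
  apply: leq_trans (subset_leq_card (_ : shadow K.+1 (del j F) \subset _)); last first.
    by rewrite (del_shadow _ _ FP) subsetUl.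
  by apply: FFK; rewrite ?cd // del_compress; apply: init_initial.
apply: card_bigcup_initial => v /eqP vj; rewrite (@shadow_id _ _ (C :\ j) K.+1) lnk_compress ?init_sub //.
  exact: init_initial.
apply: leq_trans (card_init_le _ _) _; rewrite (del_shadow _ _ FP); apply: subset_leq_card.
apply: subset_trans (subsetUr _ _); apply: subset_trans (bigcup_sup v _); last by rewrite vj.
by rewrite (@shadow_id _ _ (C :\ j) K.+1) // lP.
Qed.

(** As [v] adds the constant [2 ^ v] to every code in its link, the total splits into totals over
    the deletion and the links, each minimised by a segment. Equality of the totals forces equality
    in every part. *)
Lemma compress_sum C K j F : j \in C -> F \subset rainbow C K.+2 ->
  \sum_(x in compress C K j F) code x < \sum_(x in F) code x \/
  (initial (rainbow (C :\ j) K.+2) (del j F) /\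
   forall v, color v = j -> initial (rainbow (C :\ j) K.+1) (lnk v F)).
Proof.
move=> jC FP; set F' := compress C K j F.
have F'P : F' \subset rainbow C K.+2 := assemble_rainbow _ _ _ _ _.
have d_le := initial_sum (del_rainbow j FP); rewrite -del_compress -/F' in d_le.
have lP v : color v = j -> lnk v F \subset rainbow (C :\ j) K.+1.
  by move=> vj; have := lnk_rainbow v FP; rewrite vj.
have l_le v : color v == j -> \sum_(y in lnk v F') code (v |: y) <=
    \sum_(y in lnk v F) code (v |: y) ?= iff (lnk v F == lnk v F').
  move=> /eqP vj; have := initial_sum (lP v vj); rewrite -(lnk_compress _ _ jC vj) -/F' => lle.
  have E G : \sum_(y in lnk v G) code (v |: y) = #|lnk v G| * 2 ^ v + \sum_(y in lnk v G) code y.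
    rewrite -sum_nat_const -big_split /=; apply: eq_bigr => y; rewrite inE => /andP[vy _].
    by rewrite codeU1.
  rewrite !E lnk_compress // card_init ?subset_leq_card ?lP // -lnk_compress //.
  by split; rewrite ?leq_add2l ?eqn_add2l ?lle.
have s_le := leqif_sum (fun v vj => l_le v vj).
have := leqif_add d_le s_le; rewrite -(sum_del_lnk j (@code N) F'P) -(sum_del_lnk j (@code N) FP) => -[le eq].
have [|lt] := eqVneq (\sum_(x in F') code x) (\sum_(x in F) code x); last first.
  by left; rewrite ltn_neqAle lt.
move/eqP; rewrite eq => /andP[/eqP dE /forall_inP lE]; right; split.
  by rewrite dE del_compress; apply: init_initial.
move=> v vj; have /eqP-> := lE v (introT eqP vj).
by rewrite lnk_compress //; apply: init_initial.
Qed.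

(** If no colour lowers the total code, all deletions and links are segments. A common vertex of [x]
    and [y] would put [x] in [F] through the link of that vertex, a common missing colour through
    the deletion of that colour. *)
Lemma compressed_or_improves C K F : (forall j, j \in C -> shadow_minimal N (C :\ j)) ->
  F \subset rainbow C K.+2 ->
  (exists F', improves C K.+1 F F') \/ compressed C K.+2 F.
Proof.
move=> FFK FP.
case: (pickP [pred j in C | \sum_(x in compress C K j F) code x < \sum_(x in F) code x]).
  move=> j /andP[jC lt]; left; exists (compress C K j F).
  have [c1 c2] := compress_shadow jC (FFK j jC) FP.
  by split=> //; apply: assemble_rainbow.
move=> no; have ini j : j \in C -> initial (rainbow (C :\ j) K.+2) (del j F) /\
   forall v, color v = j -> initial (rainbow (C :\ j) K.+1) (lnk v F).
  by move=> jC; have [lt|//] := compress_sum jC FP; have := no j; rewrite /= jC lt.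
right => x y xP xF yF xy; have yP := subsetP FP y yF; split.
  move=> v vx; apply: contra xF => vy.
  have [_ /(_ v erefl)[_ lI]] := ini (color v) (rainbow_col xP vx).
  have : x :\ v \in lnk v F.
    apply: (lI _ (y :\ v)); first exact: rainbowD1.
      by rewrite inE !inE eqxx /= setD1K.
    by rewrite (codeD1 vx) (codeD1 vy) ltn_add2l in xy.
  by rewrite inE => /andP[_]; rewrite setD1K.
move=> i iC ix; apply: contraR xF => iy.
have [[_ dI] _] := ini i iC; have : x \in del i F.
  by apply: (dI _ y) => //; [apply: rainbowD1_mem | rewrite inE yF].
by rewrite inE => /andP[].
Qed.

Lemma initial_or_gap (U F : {set {set 'I_N}}) : F \subset U -> initial U F \/ exists x y,
  [/\ x \in U, x \notin F, y \in F & code x < code y] /\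
  ((forall z, z \in U -> code z < code x -> z \in F) /\
   (forall z, z \in F -> z != y -> code z < code y)).
Proof.
move=> FU; case: (pickP (mem F)) => [y0 y0F|F0]; last first.
  by left; split=> // x y _ yF; have := F0 y; rewrite /= yF.
case: (@arg_maxnP _ y0 (mem F) (@code N) y0F) => y /= yF ymax.
case: (pickP (mem (U :\: F))) => [x0 x0D|D0]; last first.
  by left; split=> // x z xU _ _; have := D0 x; rewrite /= !inE xU andbT => /negbFE.
case: (@arg_minnP _ x0 (mem (U :\: F)) (@code N) x0D) => x /=.
rewrite inE => /andP[xF xU] xmin.
have xmin' z : z \in U -> code z < code x -> z \in F.
  move=> zU zx; apply/negPn/negP => zF; have := xmin z.
  by rewrite inE zU zF leqNgt zx => /(_ isT).
have [xy|xy] := boolP (code x < code y); last first.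
  left; split=> // z w zU wF zw; apply: xmin' => //; apply: leq_trans zw _.
  by rewrite leqNgt; apply: contra xy => /leq_trans; apply; apply: ymax.
right; exists x, y; split=> //; split=> // z zF zy.
by apply: code_total; rewrite 1?eq_sym // -leqNgt ymax.
Qed.

Lemma facet_of x T : T \subset x -> #|x| = #|T|.+1 -> exists2 w, w \in x & T = x :\ w.
Proof.
move=> Tx cx; have : #|x :\: T| = 1 by rewrite cardsD (setIidPr Tx) cx subSnn.
move/eqP/cards1P => [w xTw]; have : w \in x :\: T by rewrite xTw set11.
rewrite inE => /andP[wT wx]; exists w => //; apply/eqP; rewrite eqEcard subsetD1 Tx wT /=.
by move: cx; rewrite (cardsD1 w) wx add1n => -[->].
Qed.

Lemma cofacet_of z T : T \subset z -> #|z| = #|T|.+1 ->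
  exists g, g \notin T /\ z = g |: T.
Proof.
move=> Tz cz; have [g gz ->] := facet_of Tz cz; exists g.
by rewrite !inE eqxx setD1K.
Qed.

End Compression.

(** * Exchanges in a compressed family that is not an initial segment *)

Section Exchange.

Variables (N q : nat) (qN : q < N) (C : {set 'I_q.+1}) (K : nat) (F : {set {set 'I_N}}).
Implicit Types (x y z S T : {set 'I_N}) (u v w g : 'I_N) (i : 'I_q.+1).
Local Notation color := (@color N q).
Local Notation colors := (@colors N q).
Local Notation U := (rainbow N C K.+2).
Local Notation low := (low qN).

Hypotheses (FU : F \subset U) (Fcomp : compressed C K.+2 F).

Variables x0 y0 : {set 'I_N}.
Hypotheses (x0U : x0 \in U) (x0F : x0 \notin F) (y0F : y0 \in F) (xy : code x0 < code y0).
Hypothesis ymax : forall z, z \in F -> z != y0 -> code z < code y0.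

Variable M : 'I_N.
Hypotheses (My : M \in y0) (Mmax : forall v, v \in y0 -> v <= M).

Let y0U : y0 \in U := subsetP FU y0 y0F.

Lemma compressed_mem z y v : z \in U -> y \in F -> code z < code y -> v \in z -> v \in y -> z \in F.
Proof.
move=> zU yF zy vz vy; apply/negPn/negP => zF.
by have [/(_ v vz)] := Fcomp zU zF yF zy; rewrite vy.
Qed.

Lemma gap_disjoint v : v \in x0 -> v \notin y0.
Proof. by case: (Fcomp x0U x0F y0F xy) => disj _; apply: disj. Qed.

Lemma gap_lt_max v : v \in x0 -> v < M.
Proof.
move=> vx; rewrite ltnNge; apply/negP => Mv.
suff : code y0 < code x0 by rewrite ltnNge ltnW.
apply: (@code_lt _ _ _ v) => //; first exact: gap_disjoint.
move=> w wy _; rewrite ltn_neqAle; apply/andP; split.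
  by apply: contraTneq wy => /val_inj->; apply: gap_disjoint.
exact: leq_trans (Mmax wy) Mv.
Qed.

Lemma gap_max_notin : M \notin x0.
Proof. by apply/negP => /gap_lt_max; rewrite ltnn. Qed.

(** All of [x0] lies below [M], so [x0] precedes every set through [M]. Compression therefore
    applies to [x0] and any member of [F] through [M], not only to [y0]; [gap_sep] and [gap_colors]
    record the outcome. *)
Lemma gap_lt z : M \in z -> code x0 < code z.
Proof.
by move=> Mz; apply: (@code_lt _ _ _ M) => //; [exact: gap_max_notin | move=> v /gap_lt_max].
Qed.

Lemma gap_fill z : z \in U -> M \in z -> code z < code y0 -> z \in F.
Proof. by move=> zU Mz zy; apply: compressed_mem zU y0F zy Mz My. Qed.

Lemma gap_sep z v : z \in F -> M \in z -> v \in x0 -> v \notin z.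
Proof. by move=> zF Mz; case: (Fcomp x0U x0F zF (gap_lt Mz)) => disj _; apply: disj. Qed.

Lemma gap_colors z i : z \in F -> M \in z -> i \in C -> i \notin colors x0 -> i \in colors z.
Proof. by move=> zF Mz; case: (Fcomp x0U x0F zF (gap_lt Mz)) => _; apply. Qed.

Lemma card_U z : z \in U -> #|z| = K.+2.
Proof. by case/rainbowP. Qed.

Let G := F :\ y0.

Lemma card_FG : #|F| = #|G|.+1.
Proof. by rewrite (cardsD1 y0) y0F. Qed.

(** The exchange adds at most the facet [T] to the shadow; if it adds one, a facet of [y0] lying in
    no other member of [F] pays for it. *)
Lemma shadow_swap (T : {set 'I_N}) :
  (forall u, u \in x0 -> x0 :\ u \in shadow K.+1 G \/ x0 :\ u = T) ->
  (forall u, u \in x0 -> x0 :\ u \notin shadow K.+1 G ->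
     exists2 w, w \in y0 & y0 :\ w \notin shadow K.+1 G) ->
  improves C K.+1 F (x0 |: G).
Proof.
move=> newT lost; have x0G : x0 \notin G by rewrite !inE negb_and x0F orbT.
split.
- rewrite subUset sub1set x0U; apply: subset_trans FU; exact: subD1set.
- by rewrite cardsU1 x0G card_FG.
- have shU : shadow K.+1 (x0 |: G) \subset T |: shadow K.+1 G.
    rewrite shadowU subUset subsetUr andbT; apply/subsetP=> S /shadowP[cS [x]].
    rewrite inE => /eqP-> Sx; have [|w wx ->] := facet_of Sx; first by rewrite cS card_U.
    by rewrite in_setU1; have [->|->] := newT w wx; rewrite ?eqxx ?orbT.
  have shG : shadow K.+1 G \subset shadow K.+1 F by apply: shadowS; apply: subD1set.
  case: (pickP [pred u in x0 | x0 :\ u \notin shadow K.+1 G]) => [u /andP[ux uG]|no].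
    have [w wy wG] := lost u ux uG.
    apply: leq_trans (subset_leq_card shU) _; rewrite cardsU1.
    apply: (@leq_trans #|(y0 :\ w) |: shadow K.+1 G|).
      by rewrite cardsU1 wG; case: (T \notin _); rewrite ?add0n ?leqnSn.
    rewrite subset_leq_card // subUset shG sub1set andbT; apply/shadowP; split.
      by move: (card_U y0U); rewrite (cardsD1 w) wy => -[].
    by exists y0 => //; apply: subD1set.
  apply/subset_leq_card/(subset_trans _ shG); rewrite shadowU subUset subxx andbT.
  apply/subsetP=> S /shadowP[cS [x]]; rewrite inE => /eqP-> Sx.
  have [|w wx ->] := facet_of Sx; first by rewrite cS card_U.
  by have := no w; rewrite /= wx => /negbFE.
rewrite big_setU1 //= [X in _ < X](big_setD1 y0) //= ltn_add2r //.
Qed.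

(* Here [x0] is the first missing set. At most one facet of [x0] is new, and
   exchanging [x0] and [y0] then also loses a facet of [y0]. *)
Section FewColors.

Hypothesis CK : K.+2 < #|C|.
Hypothesis xmin : forall z, z \in U -> code z < code x0 -> z \in F.

Variable u : 'I_N.
Hypotheses (ux : u \in x0) (unew : x0 :\ u \notin shadow K.+1 G).

(** Otherwise replacing [u] by [g] in [x0] gives a rainbow set before the first missing one, hence a
    member of [F] other than [y0] that covers the facet [x0 :\ u]. *)
Lemma new_below g : g < u -> color g \in C -> color g \in colors (x0 :\ u).
Proof.
move=> gu gC; apply/negPn/negP => gx.
have gx0 : g \notin x0.
  apply: contra gx => gx0; apply: mem_colors; rewrite !inE gx0 andbT.
  by apply: contraTneq gu => ->; rewrite ltnn.
have zU : g |: (x0 :\ u) \in U by apply: rainbow_swap.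
have zx := code_swap ux gx0 gu; case/negP: unew; apply/shadowP; split.
  by move: (card_U x0U); rewrite (cardsD1 u) ux => -[].
exists (g |: (x0 :\ u)); last exact: subsetUr.
rewrite !inE xmin // andbT; apply: contraTneq zx => ->.
by rewrite -leqNgt ltnW.
Qed.

Lemma new_low : u < q.+1.
Proof.
rewrite ltnNge; apply/negP => qu; have lu : low (color u) < u.
  by apply: leq_trans qu; apply: low_lt.
have := new_below lu; rewrite col_low (rainbow_col x0U ux) => /(_ isT).
by apply/negP/(rainbow_colD1 x0U ux).
Qed.

(** Let [S] be the first rainbow set of [K.+1] vertices avoiding the colour of [M]. Then [M |: S]
    does not come after [y0], so it is in [F], and [S] misses [u] by [gap_sep]. With too few
    candidates below [u], some vertex of [S] above [u] could be replaced by [u], against the choice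
    of [S]. *)
Lemma low_many : color u != color M ->
  K.+1 <= #|[set g : 'I_N | (g < u) && (color g \in C :\ color M)]|.
Proof.
move=> uM; set B := [set g : 'I_N | _]; rewrite leqNgt; apply/negP => cB.
have uq := new_low; have uC := rainbow_col x0U ux.
have s0P : y0 :\ M \in rainbow N (C :\ color M) K.+1 by apply: rainbowD1.
case: (@arg_minnP _ _ (mem (rainbow N (C :\ color M) K.+1)) (@code N) s0P) => S /= SP Smin.
have jS := rainbowD1_notin SP; have MS : M \notin S by apply: contra jS; apply: mem_colors.
have zU : M |: S \in U by apply: rainbowDU1 => //; apply: rainbow_col y0U My.
have Mz : M \in M |: S by rewrite setU11.
have zF : M |: S \in F.
  have [->//|zy] := eqVneq (M |: S) y0.
  apply: gap_fill => //; apply: code_total; rewrite 1?eq_sym // -leqNgt.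
  by rewrite codeU1 // (codeD1 My) leq_add2l Smin.
suff uS : u \in S by have := gap_sep zF Mz ux; rewrite !inE uS orbT.
apply/negPn/negP => uS.
have [w [wS uw uSw]] : exists w, [/\ w \in S, u < w & color u \notin colors (S :\ w)].
  case: (colorsP (color u) S) => [[w wS uw]|no].
    exists w; split=> //; last by rewrite uw; apply: rainbow_colD1 SP wS.
    rewrite ltn_neqAle; apply/andP; split; first by apply: contraNneq uS => /val_inj->.
    by rewrite -(lowE qN uq) uw low_le.
  have [w wS wB] : exists2 w, w \in S & w \notin B.
    apply/subsetPn; apply: contraTN cB => /subset_leq_card.
    by rewrite -leqNgt; case/rainbowP: SP => ->.
  exists w; split=> //; last first.
    by apply/negP => /(subsetP (colorsS q (subD1set _ _)))/colorsP[v vS uv]; case: no; exists v.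
  move: wB; rewrite inE (rainbow_col SP wS) andbT -leqNgt leq_eqVlt => /orP[/eqP/val_inj uw|//].
  by rewrite uw wS in uS.
have : u |: (S :\ w) \in rainbow N (C :\ color M) K.+1.
  by apply: rainbow_swap => //; rewrite !inE uM.
by move/Smin; rewrite leqNgt (code_swap wS uS uw).
Qed.

(** The vertices counted in [low_many] are low, hence of distinct colours, and by [new_below] these
    are among the [K.+1] colours of [x0 :\ u]; so they are all of them. *)
Lemma new_colors : color u != color M ->
  forall w, w \in x0 -> w != u -> color w != color M /\ low (color w) < u.
Proof.
move=> uM w wx wu; set B := [set g : 'I_N | (g < u) && (color g \in C :\ color M)].
have uq := new_low.
have colB : colors B = colors (x0 :\ u).
  apply/eqP; rewrite eqEcard; apply/andP; split.
    apply/subsetP=> i /colorsP[g]; rewrite !inE => /and3P[gu gM gC ->]; exact: new_below.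
  have -> : #|colors B| = #|B|.
    apply: card_in_imset => g h; rewrite !inE => /andP[gu _] /andP[hu _].
    by apply: (col_inj_low qN); [apply: ltn_trans uq | apply: ltn_trans uq].
  by rewrite (card_colors (rainbowD1 x0U ux)); apply: low_many.
have : color w \in colors B by rewrite colB; apply: mem_colors; rewrite !inE wu.
case/colorsP=> g; rewrite !inE => /and3P[gu gM _] wg; rewrite wg; split=> //.
by rewrite (lowE qN) // (ltn_trans gu).
Qed.

Lemma facet_cover z w : z \in G -> y0 :\ w \subset z -> w \in y0 ->
  exists g, [/\ g \notin y0 :\ w, z = g |: (y0 :\ w), g < w & code z < code y0].
Proof.
rewrite !inE => /andP[zy zF] wz wy; have zlt := ymax zF zy.
have [|g [gy zE]] := cofacet_of wz.
  by rewrite (card_U (subsetP FU z zF)) -(card_U y0U) (cardsD1 w y0) wy.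
exists g; split=> //; move: zlt; rewrite zE (codeD1 wy) codeU1 // ltn_add2r.
by rewrite ltn_exp2l.
Qed.

Lemma lost_facet : exists2 w, w \in y0 & y0 :\ w \notin shadow K.+1 G.
Proof.
have jC := rainbow_col y0U My.
have jD z : z \in U -> M \in z -> color M \notin colors (z :\ M) by exact: rainbow_colD1.
(* A colour [i] that [x0] lacks, other than that of [M], occurs in every member of [F] through [M].
   Its vertex [w] in [y0] is low, since otherwise [M] with low vertices of further colours would be
   a member without [i]. So no lower vertex of colour [i] can replace [w], and the facet [y0 :\ w]
   is lost. *)
case: (pickP [pred i in C | (i != color M) && (i \notin colors x0)]) => [i /and3P[iC ij ix]|no].
  have /colorsP[w wy iw] := gap_colors y0F My iC ix.
  have wM : w != M by apply: contraNneq ij => <-; rewrite iw.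
  exists w => //; apply/negP => /shadowP[_ [z zG wz]].
  have [g [gy zE gw zlt]] := facet_cover zG wz wy.
  have Mz : M \in z by rewrite zE !inE [M == w]eq_sym wM My orbT.
  have zF : z \in F by move: zG; rewrite !inE => /andP[].
  have := gap_colors zF Mz iC ix; rewrite zE colorsU1 inE iw (negPf (rainbow_colD1 y0U wy)) orbF.
  rewrite inE => /eqP wg.
  have wq : w < q.+1.
    rewrite ltnNge; apply/negP => qw.
    have [S [SL SC cS]] : exists S : {set 'I_q.+1},
        [/\ set0 \subset S, S \subset C :\ color M :\ i & #|S| = K.+1].
      apply: exists_superset; rewrite ?sub0set // cards0 /=.
      by move: CK; rewrite (cardsD1 (color M)) jC (cardsD1 i (C :\ _)) !inE ij iC !add1n !ltnS.
    pose Z := low @: S.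
    have Zc : colors Z = S.
      rewrite /colors -imset_comp -[RHS]imset_id; apply: eq_imset => c.
      by rewrite /= col_low.
    have ZP : Z \in rainbow N (C :\ color M) K.+1.
      have cZ : #|Z| = K.+1.
        by rewrite card_imset // => a b /(congr1 color); rewrite !col_low.
      rewrite inE cZ Zc cS !eqxx; apply: subset_trans SC _; exact: subD1set.
    have iZ : i \notin colors Z by rewrite Zc; apply/negP => /(subsetP SC); rewrite !inE eqxx.
    have MZ : M \notin Z by apply: contra (rainbowD1_notin ZP); apply: mem_colors.
    have z'U : M |: Z \in U by apply: rainbowDU1.
    have z'F : M |: Z \in F.
      apply: gap_fill; rewrite ?setU11 // codeU1 // (codeD1 My) ltn_add2l.
      apply: (@code_lt _ _ _ w); first by rewrite !inE wM.
        by apply/negP => /imsetP[c _ wc]; have := low_lt qN c; rewrite -wc ltnNge qw.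
      by move=> v /imsetP[c _ ->] _; apply: leq_trans qw; apply: low_lt.
    have := gap_colors z'F (setU11 _ _) iC ix.
    by rewrite colorsU1 inE (negPf iZ) orbF inE (negPf ij).
  have : low (color w) <= g by rewrite wg low_le.
  by rewrite (lowE qN wq) leqNgt gw.
(* now [x0] has all colours but that of [M]; in such a family every set
   through [M] consists of [M] and of low vertices below [u] *)
have xC : C :\ color M \subset colors x0.
  apply/subsetP=> i; rewrite !inE => /andP[ij iC]; apply/negPn/negP => ix.
  by have := no i; rewrite /= iC ij ix.
have jx : color M \notin colors x0.
  apply/negP => jx; have : C \subset colors x0 by rewrite -(setD1K jC) subUset sub1set jx.
  by move/subset_leq_card; rewrite (card_colors x0U) leqNgt CK.
have uC := rainbow_col x0U ux.
have uj : color u != color M by apply: contraNneq jx => <-; apply: mem_colors.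
have uq := new_low.
have cC : #|C :\ color M :\ color u| = K.+1.
  have := subset_leq_card xC; rewrite (card_colors x0U).
  move: CK; rewrite (cardsD1 (color M)) jC [#|C :\ _|](cardsD1 (color u)) !inE uj uC.
  by rewrite !add1n !ltnS => a b; apply/eqP; rewrite eqn_leq a b.
have low_z z w : z \in F -> M \in z -> w \in z -> w != M -> u < w -> color u \in colors (z :\ w).
  move=> zF Mz wz wM uw; apply/negPn/negP => uz; have zU := subsetP FU z zF.
  have unz := gap_sep zF Mz ux.
  have z'U : u |: (z :\ w) \in U by apply: rainbow_swap.
  have Mz' : M \in u |: (z :\ w) by rewrite !inE [M == w]eq_sym wM Mz orbT.
  have z'F : u |: (z :\ w) \in F.
    by apply: compressed_mem z'U zF (code_swap wz unz uw) Mz' Mz.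
  by have := gap_sep z'F Mz' ux; rewrite setU11.
have u_col z : z \in F -> M \in z -> color u \notin colors z.
  move=> zF Mz; apply/negP => /colorsP[w wz uw]; have zU := subsetP FU z zF.
  have wM : w != M by apply: contraNneq uj => <-; rewrite uw.
  have ultw : u < w.
    rewrite ltn_neqAle; apply/andP; split; last by rewrite -(lowE qN uq) uw low_le.
    by apply: contraTneq wz => /val_inj<-; apply: gap_sep ux.
  have := low_z z w zF Mz wz wM ultw.
  by rewrite uw (negPf (rainbow_colD1 zU wz)).
have z_low z w : z \in F -> M \in z -> w \in z -> w != M -> w < q.+1.
  move=> zF Mz wz wM; apply: leq_ltn_trans uq; rewrite leqNgt; apply/negP => uw.
  have /negP := u_col z zF Mz; apply; apply: (subsetP (colorsS q (subD1set z w))).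
  exact: low_z.
have z_colors z : z \in F -> M \in z -> colors (z :\ M) = C :\ color M :\ color u.
  move=> zF Mz; have zU := subsetP FU z zF; apply/eqP; rewrite eqEcard; apply/andP; split.
    apply/subsetP=> i iz; rewrite !inE; apply/and3P; split.
    - apply: contraNneq (u_col z zF Mz) => <-; exact: (subsetP (colorsS q (subD1set z M))).
    - by apply: contraNneq (jD z zU Mz) => <-.
    - by case/rainbowP: (rainbowD1 zU Mz) => _ _ /(_ i iz); rewrite !inE => /andP[].
  by rewrite cC (card_colors (rainbowD1 zU Mz)).
(* Any facet of [y0] through [M] will do: a member of [F] through [M] is determined by its low
   vertices, whose colours are forced, so it is [y0]. *)
have [w] : exists w, w \in y0 :\ M.
  apply/set0Pn; rewrite -card_gt0; by move: (card_U y0U); rewrite (cardsD1 M y0) My add1n => -[->].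
rewrite !inE => /andP[wM wy]; exists w => //; apply/negP => /shadowP[_ [z zG wz]].
move: zG; rewrite !inE => /andP[zy zF].
have Mz : M \in z by apply: (subsetP wz); rewrite !inE eq_sym wM My.
case/eqP: zy; apply/eqP; rewrite eq_sym eqEcard (card_U y0U) (card_U (subsetP FU z zF)) leqnn andbT.
apply/subsetP=> v vy; have [->//|vM] := eqVneq v M.
have : color v \in colors (z :\ M).
  by rewrite z_colors // -(z_colors y0) //; apply: mem_colors; rewrite !inE vM.
case/colorsP=> v'; rewrite !inE => /andP[v'M v'z] vv'.
suff -> : v = v' by [].
by apply: (col_inj_low qN) vv'; [apply: (z_low y0) | apply: (z_low z)].
Qed.

End FewColors.

(** At most one facet of [x0] is new. For two of them, [x0 :\ u1] and [x0 :\ u2], [new_colors] would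
    make each of the low vertices [u1], [u2] smaller than the other, unless both had the colour of
    [M], which the rainbow set [x0] excludes. *)
Lemma few_colors_improves : K.+2 < #|C| ->
  (forall z, z \in U -> code z < code x0 -> z \in F) -> improves C K.+1 F (x0 |: G).
Proof.
move=> CK xmin.
have uniq u1 u2 : u1 \in x0 -> u2 \in x0 -> x0 :\ u1 \notin shadow K.+1 G ->
    x0 :\ u2 \notin shadow K.+1 G -> u1 = u2.
  move=> u1x u2x n1 n2; apply/eqP/negPn/negP => u12.
  have nc u v : u \in x0 -> v \in x0 -> x0 :\ u \notin shadow K.+1 G ->
     x0 :\ v \notin shadow K.+1 G -> v != u -> color u = color M.
    move=> ux vx nu nv vu; apply/eqP/negPn/negP => uM.
    have [vM lv] := new_colors xmin ux nu uM vx vu.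
    have [|_ lu] := new_colors xmin vx nv vM ux _; first by rewrite eq_sym.
    have uq := new_low xmin ux nu; have vq := new_low xmin vx nv.
    by move: lu lv; rewrite !(lowE qN) // => uv /(ltn_trans uv); rewrite ltnn.
  have [_ ix _] := rainbowP _ _ _ x0U.
  have e2 : color u2 = color M by apply: (nc u2 u1).
  have e1 : color u1 = color M by apply: (nc u1 u2) => //; rewrite eq_sym.
  by case/eqP: u12; apply: ix; rewrite ?e1 ?e2.
case: (pickP [pred u in x0 | x0 :\ u \notin shadow K.+1 G]) => [u /andP[ux nu]|no].
  apply: (@shadow_swap (x0 :\ u)) => [w wx|w wx nw].
    have [|nw] := boolP (x0 :\ w \in shadow K.+1 G); first by left.
    by right; rewrite (uniq w u).
  exact: lost_facet nu.
apply: (@shadow_swap set0) => w wx; first by left; have := no w; rewrite /= wx => /negbFE.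
by have := no w; rewrite /= wx => /= -> .
Qed.

(** * Families whose members use every colour *)

Section FullColors.

Hypothesis CK : #|C| = K.+2.

Let MC : color M \in C := rainbow_col y0U My.

Lemma full_colors z : z \in U -> colors z = C.
Proof.
move=> zU; apply/eqP; rewrite eqEcard (card_colors zU) CK leqnn andbT.
by apply/subsetP; case/rainbowP: zU.
Qed.

Variable xj : 'I_N.
Hypotheses (xjx : xj \in x0) (xjM : color xj = color M).

Let b := x0 :\ xj.

Lemma base_notin v : v \in b -> color v != color M.
Proof. by move=> vb; apply: contraNneq (rainbow_colD1 x0U xjx) => vM; rewrite xjM -vM mem_colors. Qed.

(** Replacing [v] by the vertex of [y0] of the same colour gives a set entirely below [M]. It
    precedes [y0] and meets it, so it is in [F]. Thus every facet of [g |: b] except [b] is covered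
    by a member avoiding [M]. *)
Lemma base_replace g v : g < M -> color g = color M -> v \in b ->
  exists w, w |: ((g |: b) :\ v) \in F :\ y0 /\ M \notin w |: ((g |: b) :\ v).
Proof.
move=> gM gj vb; have vM := base_notin vb.
have vx : v \in x0 by move: vb; rewrite !inE => /andP[].
have gb : color g \notin colors b by rewrite gj -xjM (rainbow_colD1 x0U xjx).
have gU : g |: b \in U by apply: (rainbow_swap x0U xjx) => //; rewrite gj.
have vgb : v \in g |: b by rewrite inE vb orbT.
have : color v \in colors y0 by rewrite (full_colors y0U) (rainbow_col x0U vx).
case/colorsP=> w wy vw; exists w.
have wM : w < M.
  by rewrite ltn_neqAle Mmax // andbT; apply: contraNneq vM => /val_inj wM; rewrite vw wM.
set z := w |: _; have zU : z \in U.
  apply: rainbow_swap => //; first exact: rainbow_col y0U wy.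
  by rewrite -vw (rainbow_colD1 gU).
have zM u : u \in z -> u < M.
  rewrite !inE => /orP[/eqP->//|/andP[_ /orP[/eqP->//|/andP[_]]]]; exact: gap_lt_max.
have Mz : M \notin z by apply/negP => /zM; rewrite ltnn.
split=> //; rewrite !inE; apply/andP; split; first by apply: contraNneq Mz => ->.
apply: (compressed_mem zU y0F _ (setU11 _ _) wy).
by apply: (@code_lt _ _ _ M) => // u /zM.
Qed.

(** The exchange adds no facet: [base_replace] covers all facets of [x0] except [b], and a member of
    [F] over [b] cannot be [y0], which is disjoint from [x0]. *)
Lemma covered_improves : b \in shadow K.+1 F -> improves C K.+1 F (x0 |: G).
Proof.
move=> /shadowP[cb [z zF bz]].
have cov u : u \in x0 -> x0 :\ u \in shadow K.+1 G.
  move=> ux; apply/shadowP; split.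
    by move: (card_U x0U); rewrite (cardsD1 u) ux add1n => -[].
  have [->|uj] := eqVneq u xj.
    exists z => //; rewrite !inE zF andbT.
    have [v vb] : exists v, v \in b by apply/set0Pn; rewrite -card_gt0 cb.
    have vx : v \in x0 by move: vb; rewrite !inE => /andP[].
    by apply: contraNneq (gap_disjoint vx) => <-; apply: (subsetP bz).
  have ub : u \in b by rewrite !inE uj.
  have [w [wF _]] := base_replace (gap_lt_max xjx) xjM ub.
  by rewrite setD1K // in wF; exists (w |: (x0 :\ u)); rewrite ?subsetUr.
by apply: (@shadow_swap set0) => u ux; [left; apply: cov | rewrite cov].
Qed.

(* The fibre of [F] over a facet [c] of [y0] is moved into the fibre over [b]:
   in codimension one only [b] is gained, while [c] is lost. *)
Lemma uncovered_improves : b \notin shadow K.+1 F -> exists F', improves C K.+1 F F'.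
Proof.
move=> bF; have cb : #|b| = K.+1.
  by move: (card_U x0U); rewrite (cardsD1 xj) xjx add1n => -[].
(* A colour other than that of [M], so that the facet [c] of [y0] keeps [M]. *)
have [i] : exists i, i \in C :\ color M.
  by apply/set0Pn; rewrite -card_gt0; move: CK; rewrite (cardsD1 (color M) C) MC add1n => -[->].
rewrite !inE => /andP[iM iC].
have : i \in colors y0 by rewrite full_colors.
case/colorsP=> yi yiy iy; have : i \in colors x0 by rewrite full_colors.
case/colorsP=> xi xix ix.
pose c := y0 :\ yi; have cc : #|c| = K.+1.
  by move: (card_U y0U); rewrite (cardsD1 yi) yiy add1n => -[].
have Mc : M \in c by rewrite !inE My andbT; apply: contraNneq iM => ->; rewrite iy.
pose A := [set g | (g \notin c) && (g |: c \in F)].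
have yiA : yi \in A by rewrite inE !inE eqxx /= /c setD1K.
have ic : i \notin colors c by rewrite iy (rainbow_colD1 y0U yiy).
have Ai g : g \in A -> color g = i.
  rewrite inE => /andP[gc /(subsetP FU)/full_colors gC].
  by move: iC; rewrite -gC colorsU1 inE (negPf ic) orbF inE => /eqP.
(* Were [xi] below [g], compression would put [xi |: c] in [F], a member containing both [M] and a
   vertex of [x0]. *)
have Alt g : g \in A -> g < xi.
  move=> gA; move: (gA); rewrite inE => /andP[gc gF].
  have Mgc h : M \in h |: c by rewrite inE Mc orbT.
  rewrite ltn_neqAle; apply/andP; split.
    by apply: contraTneq (gap_sep gF (Mgc g) xix) => /val_inj->; rewrite setU11.
  rewrite leqNgt; apply/negP => xg.
  have xic : xi \notin c by apply: contra ic => xic; rewrite ix mem_colors.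
  have zU : xi |: c \in U by apply: rainbow_swap => //; rewrite -ix.
  have zF : xi |: c \in F.
    apply: (compressed_mem zU gF _ (Mgc xi) (Mgc g)).
    by rewrite !codeU1 // ltn_add2r ltn_exp2l.
  by have := gap_sep zF (Mgc xi) xix; rewrite setU11.
(* The vertex with the colour of [M] in the block of [q.+1] consecutive vertices containing [g]. As
   [g < xi < M] and [g], [xi] share a colour, this block comes before that of [M]; so [tau g < M],
   and the default of [insubd] does not occur on [A]. *)
pose tau g := insubd M (g %/ q.+1 * q.+1 + M %% q.+1).
have tauE g : g \in A -> tau g = g %/ q.+1 * q.+1 + M %% q.+1 :> nat /\ tau g < M.
  move=> gA; have gx := Alt g gA; have xM := gap_lt_max xix.
  have gxq : g %/ q.+1 < xi %/ q.+1.
    have e : g %% q.+1 = xi %% q.+1 by have := congr1 val (Ai g gA); rewrite ix.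
    by move: gx; rewrite {1}(divn_eq g q.+1) {1}(divn_eq xi q.+1) e ltn_add2r ltn_pmul2r.
  have lt : g %/ q.+1 * q.+1 + M %% q.+1 < M.
    rewrite [X in _ < X](divn_eq M q.+1) ltn_add2r ltn_pmul2r //.
    by apply: leq_trans gxq _; apply: leq_div2r; apply: ltnW.
  by rewrite /tau val_insubd (ltn_trans lt (ltn_ord M)).
have tauM g : g \in A -> color (tau g) = color M.
  by move=> /tauE[e _]; apply: val_inj; rewrite /= e modnMDl modn_mod.
have tau_inj : {in A &, injective tau}.
  move=> g h gA hA /(congr1 val) /=; rewrite (tauE g gA).1 (tauE h hA).1.
  move/addIn/eqP; rewrite eqn_pmul2r // => /eqP e; apply: val_inj => /=.
  rewrite (divn_eq g q.+1) (divn_eq h q.+1) e; congr (_ + _).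
  by have := congr1 val (etrans (Ai g gA) (esym (Ai h hA))).
have taub g : g \in A -> tau g \notin b.
  by move=> gA; apply/negP => /base_notin; rewrite tauM ?eqxx.
have addI (S : {set 'I_N}) g h : g \notin S -> g |: S = h |: S -> g = h.
  by move=> gS /setP/(_ g); rewrite !inE eqxx (negPf gS) !orbF => /esym/eqP.
pose Gam := [set g |: c | g in A]; pose B := [set tau g |: b | g in A].
have GamF : Gam \subset F by apply/subsetP=> z /imsetP[g]; rewrite inE => /andP[_ gF] ->.
have cGam : #|Gam| = #|A|.
  by rewrite card_in_imset // => g h; rewrite inE => /andP[gc _] _; apply: addI.
have Binj : {in A &, injective (fun g => tau g |: b)}.
  by move=> g h gA hA /(addI _ _ _ (taub g gA)); apply: tau_inj.
have cB : #|B| = #|A| by rewrite card_in_imset.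
have BF z : z \in B -> z \notin F.
  case/imsetP=> g gA ->; apply: contra bF => zF; apply/shadowP; split=> //.
  by exists (tau g |: b) => //; apply: subsetUr.
have BU : B \subset U.
  apply/subsetP=> z /imsetP[g gA ->]; apply: rainbow_swap; rewrite ?tauM //.
  by rewrite -xjM (rainbow_colD1 x0U xjx).
have dis : [disjoint F :\: Gam & B].
  rewrite -setI_eq0; apply/eqP/setP=> z; rewrite [RHS]inE !in_setI in_setD.
  by apply/negP => /andP[/andP[_ zF] /BF]; rewrite zF.
exists ((F :\: Gam) :|: B); split.
- by rewrite subUset BU andbT; apply: subset_trans FU; apply: subsetDl.
- by rewrite cardsU disjoint_setI0 // cards0 subn0 cB -cGam cardsD (setIidPr GamF) subnK // subset_leq_card.
- have cF : c \in shadow K.+1 F.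
    by apply/shadowP; split=> //; exists y0 => //; apply: subD1set.
  have cD : c \notin shadow K.+1 (F :\: Gam).
    apply/negP => /shadowP[_ [z]]; rewrite in_setD => /andP[zG zF] cz.
    have [|g [gc zE]] := cofacet_of cz; first by rewrite (card_U (subsetP FU z zF)) cc.
    by case/negP: zG; apply/imsetP; exists g; rewrite // inE gc -zE.
  have subF : shadow K.+1 (F :\: Gam) \subset shadow K.+1 F by apply: shadowS; apply: subsetDl.
  have subB : shadow K.+1 ((F :\: Gam) :|: B) \subset b |: shadow K.+1 (F :\: Gam).
    rewrite shadowU subUset subsetUr; apply/subsetP=> S /shadowP[cS [z]].
    case/imsetP=> g gA -> Sz; rewrite in_setU1.
    have [|w wz SE] := facet_of Sz; first by rewrite cardsU1 taub // cb cS.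
    rewrite SE; have [->|wt] := eqVneq w (tau g); first by rewrite setU1K ?taub // eqxx.
    have wb : w \in b by move: wz; rewrite in_setU1 (negPf wt).
    have [v [vF vM]] := base_replace (tauE g gA).2 (tauM g gA) wb.
    apply/orP; right; apply/shadowP; split; first by rewrite -SE.
    exists (v |: ((tau g |: b) :\ w)); last exact: subsetUr.
    rewrite in_setD; apply/andP; split; last by move: vF; rewrite in_setD1 => /andP[].
    by apply: contra vM => /imsetP[h _ ->]; rewrite inE Mc orbT.
  apply: leq_trans (subset_leq_card subB) _; rewrite cardsU1.
  apply: (@leq_trans #|c |: shadow K.+1 (F :\: Gam)|).
    by rewrite cardsU1 cD; case: (b \notin _); rewrite ?add0n ?leqnSn.
  by rewrite subset_leq_card // subUset subF sub1set cF.
have -> : \sum_(z in (F :\: Gam) :|: B) code z =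
    \sum_(z in F :\: Gam) code z + \sum_(z in B) code z.
  by rewrite -bigU //; apply: eq_bigl => z; rewrite in_setU.
rewrite [X in _ < X](big_setID Gam) /= (setIidPr GamF) addnC ltn_add2r.
rewrite !big_imset //=; last by move=> g h; rewrite inE => /andP[gc _] _; apply: addI.
have lt g : g \in A -> code (tau g |: b) < code (g |: c).
  move=> gA; apply: (@code_lt _ _ _ M); first by rewrite inE Mc orbT.
    apply/negP; rewrite in_setU1 => /orP[/eqP Mt|].
      by have := (tauE g gA).2; rewrite -Mt ltnn.
    by move/base_notin; rewrite eqxx.
  move=> v; rewrite in_setU1 => /orP[/eqP-> _|]; first by have [] := tauE g gA.
  by rewrite !inE => /andP[_ /gap_lt_max].
rewrite (big_setD1 yi) //= [X in _ < X](big_setD1 yi) //= -addSn leq_add ?lt //.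
by apply: leq_sum => g /setD1P[_ /lt/ltnW].
Qed.

End FullColors.

End Exchange.

(** Improvements strictly lower the total code, so they end at a segment, which contains [J] by
    nestedness. *)
Lemma shadow_minimal_of_improves (N q : nat) (C : {set 'I_q.+1}) K (F J : {set {set 'I_N}}) :
  (forall F : {set {set 'I_N}}, F \subset rainbow N C K.+1 ->
     initial (rainbow N C K.+1) F \/ exists F', improves C K F F') ->
  F \subset rainbow N C K.+1 -> initial (rainbow N C K.+1) J -> #|J| <= #|F| ->
  #|shadow K J| <= #|shadow K F|.
Proof.
move=> imp; have [m] := ubnP (\sum_(x in F) code x).
elim: m F => // m IHm F cF FP iJ JF; have [iF|[F' [F'P cF' shF' ltF']]] := imp F FP.
  by apply/subset_leq_card/shadowS; apply: initial_nested iJ iF JF.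
apply: leq_trans shF'; apply: IHm; rewrite ?cF' //.
by apply: leq_trans ltF' _; rewrite -ltnS.
Qed.

Theorem colored_kruskal_katona (N q : nat) (C : {set 'I_q.+1}) : q < N -> shadow_minimal N C.
Proof.
move=> qN; have [m] := ubnP #|C|; elim: m C => // m IHm C cC K F J FP iJ JF.
case: K FP iJ JF => [|K] FP iJ JF.
  rewrite !shadow0; case: (set_0Vmem F) JF => [->|[x xF] _].
    by rewrite cards0 leqn0 cards_eq0 => /eqP->; rewrite eqxx.
  have -> : F != set0 by apply/set0Pn; exists x.
  exact: leq_b1.
apply: (shadow_minimal_of_improves _ FP iJ JF) => {J iJ JF} {}F {}FP.
have FFK j : j \in C -> shadow_minimal N (C :\ j).
  by move=> jC; apply: IHm; move: cC; rewrite (cardsD1 j) jC.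
have [|Fcomp] := compressed_or_improves qN FFK FP; first by right.
have [iF|[x [y [[xU xF yF xy] [xmin ymax]]]]] := initial_or_gap FP; first by left.
right; have yU := subsetP FP y yF.
have [v0 v0y] : exists v, v \in y.
  by apply/set0Pn; rewrite -card_gt0; case/rainbowP: yU => ->.
case: (@arg_maxnP _ v0 (mem y) (fun v : 'I_N => val v) v0y) => M /= My Mmax.
(* With a spare colour, exchanging [x] and [y] suffices. With exactly [K.+2] colours the deletions
   are empty, and the move depends on whether the facet of [x] without the colour of [M] is already
   covered. *)
have [ltC|] := ltnP K.+2 #|C|.
  by exists (x |: (F :\ y)); apply: (few_colors_improves qN FP Fcomp xU xF yF xy ymax My).
rewrite leq_eqVlt => /orP[/eqP CK|]; last by rewrite ltnNge (rainbow_le yU).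
have : color q M \in colors q x by rewrite (full_colors CK xU) (rainbow_col yU My).
case/colorsP=> xj xjx /esym xjM.
have [b|b] := boolP (x :\ xj \in shadow K.+1 F).
  by exists (x |: (F :\ y)); apply: (covered_improves FP Fcomp xU xF yF xy My Mmax CK xjx xjM b).
exact: (uncovered_improves FP Fcomp xU xF yF xy My Mmax CK xjx xjM b).
Qed.

Lemma shadow_minimal_le (N q : nat) (C : {set 'I_q.+1}) K k (F J : {set {set 'I_N}}) : q < N ->
  F \subset rainbow N C K -> initial (rainbow N C K) J -> #|J| <= #|F| ->
  #|shadow k J| <= #|shadow k F|.
Proof.
move=> qN FP iJ JF; have [JP _] := iJ.
have [kK|Kk] := leqP k K; last by rewrite (shadow_gt JP Kk) cards0.
elim: K kK F J FP iJ JP JF => [|K IHK] kK F J FP iJ JP JF.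
  by move: kK; rewrite leqn0 => /eqP->; rewrite !(@shadow_id _ _ C 0).
move: kK; rewrite leq_eqVlt => /orP[/eqP->|].
  by rewrite !(@shadow_id _ _ C K.+1).
rewrite ltnS => kK.
rewrite -(@shadow_shadow _ _ C K.+1 K k F) ?kK ?leqnSn //.
rewrite -(@shadow_shadow _ _ C K.+1 K k J) ?kK ?leqnSn //.
apply: IHK => //; first exact: shadow_rainbow FP.
- exact: shadow_initial.
- exact: shadow_rainbow JP.
- exact: colored_kruskal_katona iJ JF.
Qed.

(** * Counting rainbow sets *)

Definition below (N q : nat) (C : {set 'I_q.+1}) (M k : nat) : {set {set 'I_N}} :=
  [set x in rainbow N C k | [forall v in x, v < M]].

(** The number of vertices of the Turan graph with parts [C] whose cliques [below] collects. *)
Definition count_below (N q : nat) (C : {set 'I_q.+1}) (M : nat) : nat :=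
  #|[set v : 'I_N | (v < M) && (color q v \in C)]|.

(* [turan_cliques 0 n] would be the complete graph; here there are no colours. *)
Definition turan_number (r n k : nat) : nat :=
  if r is _.+1 then turan_cliques r n k else (k == 0).

Arguments turan_number : simpl never.

Section Counting.

Variables N q : nat.
Implicit Types (x y : {set 'I_N}) (v w : 'I_N) (C : {set 'I_q.+1}) (c : 'I_q.+1).
Local Notation color := (@color N q).

Lemma belowP C M k x :
  reflect (x \in rainbow N C k /\ forall v, v \in x -> v < M) (x \in below N C M k).
Proof.
by rewrite [x \in below _ _ _ _]in_set; apply: (iffP andP) => [[xP /forall_inP xM]|[xP xM]]; split=> //; apply/forall_inP. Qed.

Lemma below_rainbow C M k : below N C M k \subset rainbow N C k.
Proof. by apply/subsetP=> x /belowP[]. Qed.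

Lemma below0 C M : #|below N C M 0| = 1.
Proof.
apply: (@eq_card1 _ set0) => x; rewrite [RHS]inE; apply/belowP/eqP => [[/rainbowP[/eqP]]|->].
  by rewrite cards_eq0 => /eqP.
split; last by move=> v; rewrite inE.
apply/rainbowP; split; first exact: cards0.
  by move=> u v; rewrite inE.
by move=> i /colorsP[v]; rewrite inE.
Qed.

Lemma below_bound0 C k : #|below N C 0 k.+1| = 0.
Proof.
apply: eq_card0 => x; apply/belowP => -[/rainbowP[cx _ _] x0].
have /set0Pn[v /x0//] : x != set0 by rewrite -card_gt0 cx.
Qed.

Lemma below_nocolor C M k : C = set0 -> #|below N C M k.+1| = 0.
Proof.
move=> C0; apply: eq_card0 => x; apply/belowP => -[/rainbow_le].
by rewrite C0 cards0.
Qed.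

Lemma below_skip C (M : 'I_N) k : color M \notin C -> below N C M.+1 k = below N C M k.
Proof.
move=> MC; apply/setP=> x; apply/belowP/belowP => -[xP xM]; split=> // v vx; last first.
  exact: ltnW (xM v vx).
rewrite ltn_neqAle -ltnS xM // andbT; apply: contraNneq MC => /val_inj <-.
exact: rainbow_col xP vx.
Qed.

Lemma below_step C (M : 'I_N) k : color M \in C ->
  #|below N C M.+1 k.+1| = #|below N C M k.+1| + #|below N (C :\ color M) M k|.
Proof.
move=> MC; rewrite (card_lnk M); congr (_ + _); apply: eq_card => x.
  rewrite inE; apply/andP/belowP => [[/belowP[xP xM] Mx]|[xP xM]].
    split=> // v vx; rewrite ltn_neqAle -ltnS xM // andbT.
    by apply: contraNneq Mx => /val_inj <-.
  split; last by apply/negP => /xM; rewrite ltnn.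
  by apply/belowP; split=> // v /xM/ltnW.
rewrite inE; apply/andP/belowP => [[Mx /belowP[xP xM]]|[xP xM]].
  split; first by have := rainbowD1 xP (setU11 M x); rewrite setU1K.
  move=> v vx; have := xM v; rewrite !inE vx orbT ltnS leq_eqVlt => /(_ isT)/orP[/eqP/val_inj vM|//].
  by rewrite vM (negPf Mx) in vx.
split; first by apply/negP => /xM; rewrite ltnn.
apply/belowP; split; first exact: rainbowDU1.
by move=> v; rewrite !inE => /orP[/eqP->//|/xM/ltnW].
Qed.

Lemma count_belowS C (M : 'I_N) :
  count_below N C M.+1 = count_below N C M + (color M \in C).
Proof.
rewrite /count_below; case: (boolP (color M \in C)) => MC.
  have -> : [set v : 'I_N | (v < M.+1) && (color v \in C)] =
            M |: [set v : 'I_N | (v < M) && (color v \in C)].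
    apply/setP=> v; rewrite !inE ltnS leq_eqVlt; case: eqVneq => [/val_inj->|vM].
      by rewrite eqxx MC.
    by rewrite -val_eqE (negPf vM).
  by rewrite cardsU1 !inE ltnn addnC.
rewrite addn0; apply: eq_card => v; rewrite !inE ltnS leq_eqVlt.
by case: eqVneq => [/val_inj->|_]; rewrite ?(negPf MC) ?andbF // !andbF.
Qed.

Lemma count_below0 C : count_below N C 0 = 0.
Proof. by apply: eq_card0 => v; rewrite inE. Qed.

Lemma count_belowE C M : M <= N ->
  count_below N C M = M %/ q.+1 * #|C| + #|[set c in C | c < M %% q.+1]|.
Proof.
elim: M => [|M IHM] MN.
  rewrite count_below0 div0n mod0n; apply/esym/eqP; rewrite mul0n cards_eq0.
  by apply/eqP/setP=> c; rewrite !inE andbF.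
have := count_belowS C (Ordinal MN); rewrite /= IHM ?(ltnW MN) // => ->.
set j := color _; have jE : j = M %% q.+1 :> nat by [].
have jU : #|[set c in C | c < (M %% q.+1).+1]| = #|[set c in C | c < M %% q.+1]| + (j \in C).
  case: (boolP (j \in C)) => jC.
    have -> : [set c in C | c < (M %% q.+1).+1] = j |: [set c in C | c < M %% q.+1].
      apply/setP=> c; rewrite !inE ltnS leq_eqVlt -jE -val_eqE.
      by case: eqVneq => [/val_inj->|//]; rewrite jC.
    by rewrite cardsU1 !inE jE ltnn andbF addnC.
  rewrite addn0; apply: eq_card => c; rewrite !inE ltnS leq_eqVlt -jE.
  by case: eqVneq => [/val_inj->|//]; rewrite (negPf jC).
rewrite -addnA -jU divnS // modnS; case: ifP => dv; last by [].
have c0 : #|[set c in C | c < 0]| = 0 by apply: eq_card0 => c; rewrite !inE andbF.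
rewrite add1n mulSn c0 addn0 [RHS]addnC; congr (_ + _).
have -> : (M %% q.+1).+1 = q.+1.
  move: (ltn_pmod M (ltn0Sn q)); rewrite leq_eqVlt => /orP[/eqP//|lt].
  by move: dv; rewrite /dvdn -[M.+1]addn1 -modnDml addn1 modn_small.
by apply: eq_card => c; rewrite !inE ltn_ord andbT.
Qed.

(** Colours recur cyclically, so of the [n] vertices counted below [M] exactly [n %/ #|C|] have the
    colour of [M]. This is the origin of the expression [n - n %/ r] in canonical
    representations. *)
Lemma count_below_link C (M : 'I_N) : color M \in C ->
  count_below N (C :\ color M) M = count_below N C M - count_below N C M %/ #|C|.
Proof.
move=> MC; rewrite !count_belowE ?(ltnW (ltn_ord M)) //.
set j := color M; set a := M %/ q.+1.
have -> : [set c in C :\ j | c < M %% q.+1] = [set c in C | c < M %% q.+1].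
  apply/setP=> c; rewrite !inE; case: eqVneq => [->|//].
  by rewrite /= ltnn andbF.
set t := #|[set c in C | _]|.
have tC : t < #|C|.
  rewrite (cardsD1 j) MC add1n ltnS; apply: subset_leq_card; apply/subsetP=> c.
  rewrite !inE => /andP[-> cj]; rewrite andbT; apply: contraTneq cj => ->.
  by rewrite /= ltnn.
rewrite divnMDl ?(leq_ltn_trans _ tC) // (divn_small tC) addn0.
by rewrite (cardsD1 j C) MC mulnDr muln1 -addnA addKn.
Qed.

Lemma count_below_le C M M' : M <= M' -> count_below N C M <= count_below N C M'.
Proof.
move=> MM; apply: subset_leq_card; apply/subsetP=> v; rewrite !inE => /andP[vM ->].
by rewrite (leq_trans vM).
Qed.

Lemma count_below_lt C (v : 'I_N) M : color v \in C -> count_below N C v < count_below N C M -> v < M.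
Proof. by move=> _; rewrite !ltnNge; apply: contra; apply: count_below_le. Qed.

(** The count grows by at most one at each vertex. *)
Lemma count_below_exists C n : n < count_below N C N ->
  exists2 M : 'I_N, color M \in C & count_below N C M = n.
Proof.
have : N <= N by []; elim: {1 4}N => [|m IHm] mN; first by rewrite count_below0.
have := count_belowS C (Ordinal mN) => /= ->.
have [lt _|] := ltnP n (count_below N C m); first exact: IHm (ltnW mN) lt.
case: (boolP (color (Ordinal mN) \in C)) => mC; last by rewrite addn0 leqNgt => /negPf->.
rewrite addn1 ltnS => nm mn; exists (Ordinal mN) => //=.
by apply/eqP; rewrite eqn_leq nm mn.
Qed.

Lemma count_below_setT M : M <= N -> count_below N [set: 'I_q.+1] M = M.
Proof.
elim: M => [|M IHM] MN; first exact: count_below0.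
by have := count_belowS setT (Ordinal MN); rewrite inE /= IHM ?(ltnW MN) // addn1.
Qed.

End Counting.

(** Both sides obey the recursion of [below_step], and by [count_below_link] the counts in the links
    agree again. Vertices of irrelevant colour are skipped on one side at a time, whence the
    induction on [M + M']. *)
Lemma below_congr (N q N' q' : nat) (C : {set 'I_q.+1}) (C' : {set 'I_q'.+1}) M M' k :
  M <= N -> M' <= N' -> #|C| = #|C'| -> count_below N C M = count_below N' C' M' ->
  #|below N C M k| = #|below N' C' M' k|.
Proof.
have [m] := ubnP (M + M'); elim: m M M' C C' k => // m IHm M M' C C' k.
rewrite ltnS => Mm MN MN' CC; case: k => [|k]; first by rewrite !below0.
case: M Mm MN => [|M] Mm MN.
  rewrite count_below0 below_bound0 => /esym cM'.
  apply/esym/eq_card0 => x; apply/belowP => -[xP xM].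
  have /set0Pn[v vx] : x != set0 by rewrite -card_gt0; case/rainbowP: xP => ->.
  have : v \in [set v : 'I_N' | (v < M') && (color q' v \in C')].
    by rewrite inE xM // (rainbow_col xP vx).
  by rewrite (cards0_eq cM') inE.
have MmO := IHm M M'; have [MC|MC] := boolP (color q (Ordinal MN) \in C); last first.
  have := count_belowS C (Ordinal MN); have := below_skip k.+1 MC => /= -> ->.
  by rewrite (negPf MC) addn0; apply: IHm => //; apply: ltnW.
case: M' Mm MN' MmO => [|M'] Mm MN' _.
  rewrite count_below0 => cM; have := count_belowS C (Ordinal MN).
  by rewrite /= cM MC addn1.
have [MC'|MC'] := boolP (color q' (Ordinal MN') \in C'); last first.
  have := count_belowS C' (Ordinal MN'); have := below_skip k.+1 MC' => /= -> ->.
  by rewrite (negPf MC') addn0; apply: IHm => //; [rewrite -addnS | apply: ltnW].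
have := count_belowS C' (Ordinal MN'); have := count_belowS C (Ordinal MN) => /= -> ->.
rewrite MC MC' !addn1 => -[cc].
have := below_step k MC; have := below_step k MC' => /= -> ->.
have lt : M + M' < m by apply: leq_trans Mm; rewrite addSn addnS ltnS.
congr (_ + _); first by apply: IHm; rewrite ?(ltnW MN) ?(ltnW MN').
apply: IHm; rewrite ?(ltnW MN) ?(ltnW MN') //.
  by move: CC; rewrite (cardsD1 (color q (Ordinal MN)) C) MC (cardsD1 (color q' (Ordinal MN')) C') MC' => -[].
have := count_below_link MC; have := count_below_link MC' => /= -> ->.
by rewrite cc CC.
Qed.

Lemma turan_number_below (N q : nat) (C : {set 'I_q.+1}) M k : M <= N ->
  #|below N C M k| = turan_number #|C| (count_below N C M) k.
Proof.
move=> MN; rewrite /turan_number; case cC: #|C| => [|r].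
  case: k => [|k]; first by rewrite below0.
  by rewrite below_nocolor //; apply/eqP; rewrite -cards_eq0 cC.
set n := count_below N C M; rewrite (@below_congr N q n r C setT M n) //.
- apply: eq_card => x; rewrite !inE subsetT andbT; apply/andP/andP.
    case=> /andP[cx /imset_injP ix] _; split=> //.
    apply/forall_inP => u ux; apply/forall_inP => v vx; apply/implyP => uv.
    by apply: contra uv => /eqP uv; apply/eqP/ix => //; apply: val_inj.
  case=> cx /forall_inP cl; split; last by apply/forall_inP.
  rewrite cx /=; apply/imset_injP => u v ux vx uv; apply/eqP/negPn/negP => neq.
  have /forall_inP/(_ v vx)/implyP/(_ neq) := cl u ux.
  by rewrite /turan_graph; have /= -> := congr1 val uv; rewrite eqxx.
- by rewrite cardsT card_ord.
- by rewrite count_below_setT.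
Qed.

Lemma turan_number0 r n : turan_number r n 0 = 1.
Proof.
case: r => [//|r]; have := @turan_number_below n r setT n 0 (leqnn n).
by rewrite below0 cardsT card_ord count_below_setT.
Qed.

Lemma turan_number_n0 r k : turan_number r 0 k.+1 = 0.
Proof.
case: r => [//|r]; have := @turan_number_below 0 r setT 0 k.+1 (leqnn _).
by rewrite below_bound0 cardsT card_ord count_below_setT.
Qed.

(** Deletes the last vertex; its neighbours span a Turan graph with one part fewer. *)
Lemma turan_numberS r n k :
  turan_number r.+1 n.+1 k.+1 = turan_number r.+1 n k.+1 + turan_number r (n - n %/ r.+1) k.
Proof.
have cT : #|[set: 'I_r.+1]| = r.+1 by rewrite cardsT card_ord.
have := @below_step n.+1 r setT ord_max k (in_setT _); rewrite !turan_number_below //.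
have MC : color r (@ord_max n) \in setT by rewrite inE.
rewrite (count_below_link MC) !count_below_setT // cT => ->; congr (_ + turan_number _ _ _).
by move: cT; rewrite (cardsD1 (color r (@ord_max n)) setT) inE add1n => -[].
Qed.

Lemma turan_number_complete r n k : n <= r -> turan_number r n k = 'C(n, k).
Proof.
elim: n r k => [|n IHn] r [|k] nr; rewrite ?turan_number0 ?bin0 ?turan_number_n0 //.
case: r nr => [//|r] nr; rewrite turan_numberS divn_small // subn0 !IHn //.
exact: ltnW.
Qed.

(* Counts the faces of the join of [r] discrete sets by their intersection with
   the sets obtained by deleting one point of each. *)
Lemma turan_number_shift r n i :
  \sum_(k < i.+1) 'C(r - k, i - k) * turan_number r n k = turan_number r (n + r) i.
Proof.
have [m] := ubnP (r + n); elim: m r n i => // m IHm r n i rn.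
case: i => [|i]; first by rewrite big_ord_recl big_ord0 !turan_number0 bin0.
case: r rn => [|r] rn.
  rewrite big_ord_recl big1 ?addn0 // => k _ /=.
  by rewrite muln0.
case: n rn => [|n] rn.
  rewrite big_ord_recl turan_number0 muln1 big1 ?addn0 => [|k _]; last first.
    by rewrite turan_number_n0 muln0.
  by rewrite !subn0 add0n turan_number_complete.
have E k : (k < i.+2)%N -> turan_number r.+1 n.+1 k = turan_number r.+1 n k +
    (if k is k'.+1 then turan_number r (n - n %/ r.+1) k' else 0).
  by case: k => [|k] _; rewrite ?turan_numberS ?turan_number0.
under eq_bigr => k _ do rewrite E // mulnDr.
rewrite big_split /= IHm; last by rewrite addnS ltnS in rn.
rewrite [X in _ + X]big_ord_recl muln0 add0n.
rewrite [n.+1 + _]addSn turan_numberS; congr (_ + _).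
transitivity (\sum_(k < i.+1) 'C(r - k, i - k) * turan_number r (n - n %/ r.+1) k).
  by apply: eq_bigr => k _; rewrite lift0 !subSS.
rewrite IHm; last first.
  apply: (@leq_ltn_trans (r + n)); first by rewrite leq_add2l leq_subr.
  by move: rn; rewrite addSn addnS ltnS => /ltnW.
(* Adding [r.+1] vertices raises the quotient by one, so the link gains [r] vertices: the shift is
   inherited. *)
congr (turan_number r _ i); rewrite divnDr ?dvdnn // divnn /= addn1.
by rewrite addnS subSS addnBAC // leq_div.
Qed.

(** * Initial segments of canonical length *)

(** Canonical representations with natural entries, as lists whose tail is the representation used
    in a link. *)
Fixpoint canonical (r K : nat) (ns : seq nat) : bool :=
  if ns is n :: ns' then
    [&& 0 < K, K <= r, K <= n &
        if ns' is n' :: _ then (n' < n - n %/ r) && canonical r.-1 K.-1 ns' else true]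
  else false.

Fixpoint turan_sum (r k : nat) (ns : seq nat) {struct ns} : nat :=
  if ns is n :: ns' then
    turan_number r n k + (if k is k'.+1 then turan_sum r.-1 k' ns' else 0)
  else 0.

Lemma turan_sum1 r k n : turan_sum r k [:: n] = turan_number r n k.
Proof. by case: k => [|k]; apply: addn0. Qed.

Section CanonicalSegment.

Variables N q : nat.
Hypothesis qN : q < N.
Implicit Types (x y T : {set 'I_N}) (v w : 'I_N) (C : {set 'I_q.+1}).

(** Among the low vertices below [M] at least [K] have colours in [C], all distinct, so one of these
    colours is absent from [T]. *)
Lemma below_extend C M K k T : k < K -> K <= #|C| -> K <= count_below N C M ->
  T \in below N C M k -> exists v, v |: T \in below N C M k.+1.
Proof.
move=> kK KC KM /belowP[TP TM].
pose A := [set v : 'I_N | [&& v < M, v < q.+1 & color q v \in C]].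
have cA : K <= #|A|.
  have [qM|Mq] := leqP q.+1 M.
    apply: leq_trans KC _; rewrite -(card_imset _ (can_inj (col_low qN))).
    apply: subset_leq_card; apply/subsetP=> v /imsetP[c cC ->].
    by rewrite inE col_low cC low_lt (leq_trans (low_lt qN c)).
  apply: leq_trans KM _; apply: subset_leq_card; apply/subsetP=> v.
  by rewrite !inE => /andP[vM ->]; rewrite vM (ltn_trans vM).
have cAc : #|colors q A| = #|A|.
  apply: card_in_imset => u v; rewrite !inE => /and3P[_ uq _] /and3P[_ vq _].
  exact: (col_inj_low qN).
have [i] : exists2 i, i \in colors q A & i \notin colors q T.
  apply/subsetPn; apply: contraL kK => /subset_leq_card.
  by rewrite cAc (card_colors TP) -leqNgt; apply: leq_trans.
case/colorsP=> v; rewrite inE => /and3P[vM _ vC] -> vT; exists v; apply/belowP; split.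
  exact: rainbowU1.
by move=> w; rewrite !inE => /orP[/eqP->//|/TM].
Qed.

Lemma below_shadow C M K k : k <= K -> K <= #|C| -> K <= count_below N C M ->
  below N C M k \subset shadow k (below N C M K).
Proof.
move=> kK KC KM; apply/subsetP=> T TB.
have cT : #|T| = k by case/belowP: TB => /rainbowP[].
apply/shadowP; split=> //; move Em: (K - k) => m; elim: m k T kK TB cT Em => [|m IHm] k T kK TB cT Em.
  exists T => //; suff -> : K = k by [].
  by apply/eqP; rewrite eqn_leq kK andbT -subn_eq0 Em.
have ltkK : k < K by rewrite -subn_gt0 Em.
have [v vB] := below_extend ltkK KC KM TB.
have [||x xB vx] := IHm k.+1 (v |: T) ltkK vB.
- by case/belowP: vB => /rainbowP[].
- by rewrite subnS Em.
- by exists x => //; apply: subset_trans vx; apply: subsetUr.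
Qed.

Lemma below_initial C M K : initial (rainbow N C K) (below N C M K).
Proof.
split; first exact: below_rainbow.
move=> x y xP /belowP[_ yM] /code_ltP[w [wy wx wmax]]; apply/belowP; split=> // v vx.
case: (boolP (v \in y)) => vy; first exact: yM.
exact: ltn_trans (wmax v vx vy) (yM w wy).
Qed.

(** Let [M] be the vertex preceded by exactly [n] vertices with colours in [C]. The segment consists
    of the rainbow sets below [M] and of [M] joined to the segment of the tail, built in the
    remaining colours. The condition [n' < n - n %/ r] says that the latter stays below [M]; the
    last clause carries this through the induction. *)
Lemma canonical_segment ns C K : canonical #|C| K ns -> head 0 ns < count_below N C N ->
  exists J, [/\ initial (rainbow N C K) J, #|J| = turan_sum #|C| K ns,
    forall k, k <= K -> turan_sum #|C| k ns <= #|shadow k J| &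
    forall x v, x \in J -> v \in x -> count_below N C v <= head 0 ns].
Proof.
elim: ns C K => [//|n ns IHns] C K /and4P[K0 KC Kn can] nN.
rewrite /= in nN.
have [M MC nM] := count_below_exists nN; have MN := ltnW (ltn_ord M).
have bM x v : x \in below N C M K -> v \in x -> count_below N C v <= n.
  by case/belowP=> _ xM /xM vM; rewrite -nM; apply: count_below_le; apply: ltnW.
case: ns IHns can => [|n' ns] IHns can.
  exists (below N C M K); split=> //; first exact: below_initial.
    by rewrite turan_sum1 turan_number_below // nM.
  move=> k kK; rewrite turan_sum1 -nM -turan_number_below //; apply: subset_leq_card.
  by apply: below_shadow; rewrite ?nM.
case/andP: can => n'n can; case: K K0 KC Kn bM can => // K _ KC Kn bM /= can.
have cC : #|C :\ color q M| = #|C|.-1 by rewrite (cardsD1 (color q M) C) MC.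
have n'M : n' < count_below N (C :\ color q M) M by rewrite count_below_link // nM.
have [||J' [J'I cJ' shJ' J'n]] := IHns (C :\ color q M) K; first by rewrite cC.
  exact: leq_trans n'M (count_below_le _ _ MN).
have [J'P iJ'] := J'I.
have J'M y v : y \in J' -> v \in y -> v < M.
  move=> yJ vy; have yP := subsetP J'P y yJ.
  apply: count_below_lt (rainbow_col yP vy) _; exact: leq_ltn_trans (J'n y v yJ vy) n'M.
have MJ' y : y \in J' -> M \notin y by move=> yJ; apply/negP => /(J'M y M yJ); rewrite ltnn.
have Mb x k : x \in below N C M k -> M \notin x.
  by case/belowP=> _ xM; apply/negP => /xM; rewrite ltnn.
pose L := [set M |: y | y in J']; pose J := below N C M K.+1 :|: L.
have JP : J \subset rainbow N C K.+1.
  rewrite subUset below_rainbow; apply/subsetP=> x /imsetP[y yJ ->].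
  by apply: rainbowDU1 => //; apply: (subsetP J'P).
have JM x v : x \in J -> v \in x -> v <= M.
  rewrite inE => /orP[/belowP[_ xM] /xM/ltnW//|/imsetP[y yJ ->]].
  by rewrite !inE => /orP[/eqP->//|/(J'M y v yJ)/ltnW].
have JMn x : x \in J -> M \notin x -> x \in below N C M K.+1.
  by rewrite inE => /orP[//|/imsetP[y yJ ->]]; rewrite setU11.
exists J; split.
- split=> // x z xP zJ xz.
  have xM v : v \in x -> v <= M.
    move=> vx; have [w [wz wx wmax]] := code_ltP xz.
    have [vz|vz] := boolP (v \in z); first exact: JM zJ vz.
    by apply: leq_trans (ltnW (wmax v vx vz)) _; apply: JM zJ wz.
  have [Mx|Mx] := boolP (M \in x); last first.
    rewrite inE; apply/orP; left; apply/belowP; split=> // v vx.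
    by rewrite ltn_neqAle xM // andbT; apply: contraNneq Mx => /val_inj<-.
  have Mz : M \in z.
    apply/negPn/negP => Mz; have := JMn z zJ Mz; case/belowP=> _ zM.
    suff : code z < code x by rewrite ltnNge ltnW.
    by apply: (@code_lt _ _ _ M) => // v /zM.
  move: zJ; rewrite inE => /orP[/Mb/negP//|/imsetP[y yJ zE]].
  rewrite inE; apply/orP; right; apply/imsetP; exists (x :\ M); last by rewrite setD1K.
  apply: (iJ' _ y) => //; first exact: rainbowD1.
  by move: xz; rewrite (codeD1 Mx) zE codeU1 ?ltn_add2l // MJ'.
- have dis : [disjoint below N C M K.+1 & L].
    rewrite -setI_eq0; apply/eqP/setP=> x; rewrite [RHS]inE in_setI.
    by apply/negP => /andP[/Mb Mx /imsetP[y _ xE]]; rewrite xE setU11 in Mx.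
  rewrite /= cardsU disjoint_setI0 // cards0 subn0 turan_number_below // nM; congr (_ + _).
  rewrite card_in_imset ?cJ' ?cC // => y z yJ zJ yz.
  by rewrite -(setU1K (MJ' y yJ)) yz setU1K // MJ'.
- case=> [_|k kK] /=.
    rewrite turan_number0 shadow0 addn0; case: eqP => // J0.
    suff : 0 < #|below N C M K.+1|.
      by rewrite card_gt0 => /set0Pn[x xB]; have := in_set0 x; rewrite -J0 inE xB.
    have : set0 \in shadow 0 (below N C M K.+1).
      apply: (subsetP (below_shadow _ _ _)); rewrite ?nM //; apply/belowP; split.
        have : 0 < #|below N C M 0| by rewrite below0.
        by rewrite card_gt0 => /set0Pn[y /belowP[yP _]]; move: (yP) => /rainbowP[/eqP]; rewrite cards_eq0 => /eqP <-.
      by move=> v; rewrite inE.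
    by case/shadowP=> _ [x xB _]; rewrite card_gt0; apply/set0Pn; exists x.
  rewrite (card_lnk M) lnk_shadow; apply: leq_add.
    rewrite -nM -turan_number_below //; apply: subset_leq_card; apply/subsetP=> x xB.
    rewrite inE (Mb _ _ xB) andbT; apply: (subsetP (shadowS _ (subsetUl _ _))).
    by apply: (subsetP (below_shadow kK KC _)); rewrite ?nM.
  rewrite -cC; apply: leq_trans (shJ' k kK) _; apply: subset_leq_card; apply: shadowS.
  apply/subsetP=> y yJ; rewrite !inE MJ' //=; apply/orP; right.
  by apply/imsetP; exists y.
move=> x v; rewrite inE => /orP[xB vx|/imsetP[y yJ ->]]; first exact: bM xB vx.
rewrite !inE => /orP[/eqP->|/(J'M y v yJ) vM]; rewrite -nM //.
by apply: count_below_le; apply: ltnW.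
Qed.

End CanonicalSegment.

(** * Gluing initial segments along a new colour *)

Section Glue.

Variables (Q q : nat).
Hypothesis Q0 : 0 < Q.
Local Notation N := (Q * q.+1).
Implicit Types (C : {set 'I_q.+1}) (i j : 'I_q.+1).

Let qN : q < N. Proof. exact: leq_pmull. Qed.

Lemma vertex_lt j (l : 'I_Q) : l * q.+1 + j < N.
Proof.
apply: (@leq_trans (l.+1 * q.+1)); last by rewrite leq_mul2r ltn_ord orbT.
by rewrite mulSn addnC ltn_add2r.
Qed.

Definition vertex j (l : 'I_Q) : 'I_N := Ordinal (vertex_lt j l).

Lemma color_vertex j l : color q (vertex j l) = j.
Proof. by apply: val_inj; rewrite /= modnMDl modn_small. Qed.

Lemma sum_color j (f : nat -> nat) :
  \sum_(v : 'I_N | color q v == j) f (v %/ q.+1) = \sum_(l < Q) f l.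
Proof.
have lev (v : 'I_N) : v %/ q.+1 < Q by rewrite ltn_divLR.
rewrite (reindex_onto (vertex j) (fun v => Ordinal (lev v))) /=; last first.
  by move=> v /eqP vj; apply: val_inj; rewrite /= -vj /= -divn_eq.
apply: eq_big => [l|l _]; last by rewrite divnMDl // divn_small // addn0.
rewrite color_vertex eqxx /=; apply/eqP; apply: val_inj => /=.
by rewrite divnMDl // divn_small // addn0.
Qed.

Lemma sum_nth (f : nat -> nat) (bs : seq nat) : f 0 = 0 -> size bs <= Q ->
  \sum_(l < Q) f (nth 0 bs l) = \sum_(b <- bs) f b.
Proof.
move=> f0 sQ; rewrite [RHS](big_nth 0) -(big_mkord xpredT (fun l => f (nth 0 bs l))).
rewrite (big_cat_nat (n := size bs)) //=.
have -> : \sum_(size bs <= i < Q) f (nth 0 bs i) = 0; last exact: addn0.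
by rewrite big_nat_cond big1 // => l /andP[/andP[sl _] _]; rewrite nth_default.
Qed.

(** One vertex of a fixed colour varies while the others stay low. A large [Q] thus makes room for
    segments of any required length. *)
Lemma rainbow_card_ge C K : 0 < K -> K <= #|C| -> Q <= #|rainbow N C K|.
Proof.
case: K => // K _ KC; have [j jC] : exists j, j \in C.
  by apply/set0Pn; rewrite -card_gt0; apply: leq_trans KC.
have [||S [_ SC cS]] := @exists_superset _ set0 (C :\ j) K; first exact: sub0set.
  by rewrite cards0; move: KC; rewrite (cardsD1 j C) jC.
pose Z := low qN @: S.
have ZP : Z \in rainbow N (C :\ j) K.
  have cZ : #|Z| = K by rewrite card_imset //; apply: (can_inj (col_low qN)).
  have Zc : colors q Z = S.
    rewrite /colors -imset_comp -[RHS]imset_id; apply: eq_imset => c.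
    by rewrite /= col_low.
  by rewrite inE cZ Zc cS !eqxx.
rewrite -{1}(card_ord Q) -(card_imset (f := fun l => vertex j l |: Z)) => [|l l'].
  apply: subset_leq_card; apply/subsetP=> x /imsetP[l _ ->].
  by apply: rainbowDU1; rewrite color_vertex.
move/setP/(_ (vertex j l)); rewrite !inE eqxx /= => /esym/orP[/eqP|].
  by move/(congr1 val) => /= /addIn/eqP; rewrite eqn_pmul2r // => /eqP/val_inj.
move/(mem_colors q); rewrite color_vertex => jZ.
by have := rainbowD1_notin ZP; rewrite jZ.
Qed.

(** Coloured Kruskal-Katona for the family with deletion [I] and links of sizes [bs] at the vertices
    of colour [j]. All these links lie in the segment of size [b], which accounts for what they add
    to the part of the shadow without colour [j]. *)
Lemma shadow_glue C j K k (I J : {set {set 'I_N}}) (b : nat) (bs : seq nat) :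
  j \in C -> initial (rainbow N C K.+1) J -> I \subset rainbow N (C :\ j) K.+1 ->
  size bs <= Q -> (forall b', b' \in bs -> b' <= b) -> b <= #|rainbow N (C :\ j) K| ->
  #|J| <= #|I| + sumn bs ->
  #|shadow k.+1 J| <=
    #|shadow k.+1 I :|: shadow k.+1 (init (rainbow N (C :\ j) K) b)|
    + \sum_(b' <- bs) #|shadow k (init (rainbow N (C :\ j) K) b')|.
Proof.
move=> jC iJ IP sQ bsb bP cJ; set P := rainbow N (C :\ j) K.
(* Vertices of colour [j] beyond the end of the list get the default size 0, hence an empty link. *)
pose X (v : 'I_N) := init P (nth 0 bs (v %/ q.+1)).
have nb l : nth 0 bs l <= b.
  have [lt|ge] := ltnP l (size bs); first by apply/bsb/mem_nth.
  by rewrite nth_default.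
pose A := assemble C K j I X.
have AP : A \subset rainbow N C K.+1 := assemble_rainbow _ _ _ _ _.
have dA : del j A = I by apply: del_assemble.
have lA v : color q v == j -> lnk v A = X v.
  by move=> /eqP vj; apply: lnk_assemble; rewrite ?init_sub.
have cA : #|J| <= #|A|.
  rewrite (card_del_lnk j AP) dA; apply: leq_trans cJ _; rewrite leq_add2l.
  have -> : \sum_(v | color q v == j) #|lnk v A| =
      \sum_(v : 'I_N | color q v == j) nth 0 bs (v %/ q.+1).
    by apply: eq_bigr => v vj; rewrite lA // card_init // (leq_trans (nb _)).
  by rewrite (sum_color j (nth 0 bs)) (sum_nth (f := id)) // sumnE.
apply: leq_trans (shadow_minimal_le k.+1 qN AP iJ cA) _.
rewrite (card_del_lnk j (shadow_rainbow k.+1 AP)); apply: leq_add.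
  rewrite (del_shadow _ _ AP) dA; apply/subset_leq_card/setUS/bigcupsP => v vj.
  by rewrite lA //; apply/shadowS/init_mono.
have -> : \sum_(v | color q v == j) #|lnk v (shadow k.+1 A)| =
    \sum_(v : 'I_N | color q v == j) #|shadow k (init P (nth 0 bs (v %/ q.+1)))|.
  by apply: eq_bigr => v vj; rewrite lnk_shadow lA.
rewrite (sum_color j (fun l => #|shadow k (init P (nth 0 bs l))|)).
rewrite (sum_nth (f := fun b => #|shadow k (init P b)|)) //.
apply: eq_card0 => T; apply/shadowP => -[_ [x]]; rewrite inE => /andP[_].
by rewrite ltn0.
Qed.

End Glue.

(** * Cliques and cycles of induced subgraphs *)

Definition cliques (V : finType) (e : rel V) (S : {set V}) (k : nat) : {set {set V}} :=
  [set F : {set V} | [&& F \subset S, #|F| == k & clique e F]].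

Definition neighbours (V : finType) (e : rel V) (v : V) (S : {set V}) : {set V} :=
  [set u in S | e v u].

Fixpoint links (V : finType) (e : rel V) (S : {set V}) (ws : seq V) : seq {set V} :=
  if ws is w :: ws' then neighbours e w S :: links e (S :\ w) ws' else [::].

Section Cliques.

Variables (V : finType) (e : rel V).
Hypotheses (e_sym : symmetric e) (e_irr : irreflexive e).
Implicit Types (S F G H L X : {set V}) (u v w : V) (ws : seq V).

Lemma cliqueP F : reflect {in F &, forall u v, u != v -> e u v} (clique e F).
Proof.
apply: (iffP forall_inP) => [cl u v uF vF uv|cl u uF].
  by have /forall_inP/(_ v vF)/implyP := cl u uF; apply.
by apply/forall_inP => v vF; apply/implyP; apply: cl.
Qed.

Lemma cliquesP S k F : reflect [/\ F \subset S, #|F| = k & clique e F] (F \in cliques e S k).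
Proof.
rewrite inE; apply: (iffP and3P) => [[FS /eqP cF cl]|[FS cF cl]]; split=> //.
exact/eqP.
Qed.

Lemma clique_sub F G : G \subset F -> clique e F -> clique e G.
Proof.
move=> /subsetP GF /cliqueP cl; apply/cliqueP => u v uG vG.
by apply: cl; apply: GF.
Qed.

Lemma cliqueU1 v F : v \notin F ->
  clique e (v |: F) = clique e F && [forall u in F, e v u].
Proof.
move=> vF; apply/idP/andP => [cl|[/cliqueP cl /forall_inP vn]].
  split; first by apply: clique_sub cl; apply: subsetUr.
  apply/forall_inP => u uF; move/cliqueP: cl; apply; rewrite ?setU11 ?inE ?uF ?orbT //.
  by apply: contraNneq vF => ->.
apply/cliqueP => u w; rewrite !inE => /orP[/eqP->|uF] /orP[/eqP->|wF] uw.
- by rewrite eqxx in uw.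
- exact: vn.
- by rewrite e_sym; apply: vn.
- exact: cl.
Qed.

Lemma cliques_sub S S' k : S' \subset S -> cliques e S' k \subset cliques e S k.
Proof.
move=> SS; apply/subsetP=> F /cliquesP[FS cF cl]; apply/cliquesP; split=> //.
exact: subset_trans SS.
Qed.

Lemma cliques0 S : cliques e S 0 = [set set0].
Proof.
apply/setP=> F; rewrite !inE; apply/and3P/eqP => [[_ ]|->].
  by rewrite cards_eq0 => /eqP.
by split; rewrite ?sub0set ?cards0 //; apply/cliqueP => u v; rewrite inE.
Qed.

Lemma cliques_set0 k : cliques e set0 k.+1 = set0.
Proof.
apply/setP=> F; rewrite [RHS]inE; apply/cliquesP => -[].
by rewrite subset0 => /eqP->; rewrite cards0.
Qed.

Lemma cliques_gt S k l : cliques e S k = set0 -> k <= l -> cliques e S l = set0.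
Proof.
move=> S0 kl; apply/setP=> F; rewrite [RHS]inE; apply/cliquesP => -[FS cF cl].
have [||G [_ GF cG]] := @exists_superset V set0 F k; rewrite ?sub0set ?cards0 ?cF //.
suff : G \in cliques e S k by rewrite S0 inE.
by apply/cliquesP; split=> //; [apply: subset_trans FS | apply: clique_sub cl].
Qed.

Lemma cliques_del S w k :
  [set F in cliques e S k | w \notin F] = cliques e (S :\ w) k.
Proof.
apply/setP=> F; rewrite inE [RHS]inE subsetD1 [F \in cliques _ _ _]inE.
by case: (F \subset S); case: (w \notin F); rewrite ?andbT ?andbF.
Qed.

Lemma cliques_lnk S w k : w \in S ->
  lnk w (cliques e S k.+1) = cliques e (neighbours e w S) k.
Proof.
move=> wS; apply/setP=> F; rewrite inE; apply/andP/cliquesP.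
  case=> wF /cliquesP[]; rewrite cardsU1 wF cliqueU1 // => FS [cF] /andP[cl /forall_inP wn].
  split=> //; apply/subsetP=> u uF; rewrite inE wn // andbT (subsetP FS) //.
  by rewrite inE uF orbT.
case=> /subsetP FN cF cl; have wF : w \notin F.
  by apply/negP => /FN; rewrite inE e_irr andbF.
split=> //; apply/cliquesP; rewrite cardsU1 wF cF cliqueU1 // cl; split=> //.
  rewrite subUset sub1set wS; apply/subsetP=> u /FN; by rewrite inE => /andP[].
by apply/forall_inP => u /FN; rewrite inE => /andP[].
Qed.

Lemma card_cliques_step S w k : w \in S ->
  #|cliques e S k.+1| = #|cliques e (S :\ w) k.+1| + #|cliques e (neighbours e w S) k|.
Proof. by move=> wS; rewrite (card_lnk w) cliques_del cliques_lnk. Qed.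

Lemma cliques_neighbours S v k : v \in S -> cliques e S k.+1 = set0 ->
  cliques e (neighbours e v S) k = set0.
Proof.
move=> vS S0; apply/eqP; rewrite -cards_eq0; move: (card_cliques_step k vS).
by rewrite S0 cards0 => /esym/eqP; rewrite addn_eq0 => /andP[].
Qed.

Lemma setD_cons S w ws : S :\: [set x in w :: ws] = (S :\ w) :\: [set x in ws].
Proof. by apply/setP=> x; rewrite !inE negb_or; case: (x == w); rewrite ?andbF. Qed.

Lemma card_cliques_peel ws S k : uniq ws -> {subset ws <= S} ->
  #|cliques e S k.+1| = #|cliques e (S :\: [set x in ws]) k.+1|
    + \sum_(X <- links e S ws) #|cliques e X k|.
Proof.
elim: ws S => [|w ws IHws] S /=.
  by rewrite big_nil addn0 => _ _; congr #|cliques e _ _|; apply/setP=> x; rewrite !inE.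
case/andP=> wws uws sub; rewrite big_cons (@card_cliques_step S w k) ?sub ?mem_head //.
rewrite setD_cons (IHws (S :\ w)) //; first by rewrite -addnA [X in _ + X]addnC addnA.
move=> x xws; rewrite !inE sub ?inE ?xws ?orbT // andbT.
by apply: contraNneq wws => <-.
Qed.

Lemma links_sub ws S X : {subset ws <= S} -> uniq ws -> X \in links e S ws ->
  exists2 w, w \in ws & X \subset neighbours e w S.
Proof.
elim: ws S => [//|w ws IHws] S sub /= /andP[wws uws].
rewrite inE => /orP[/eqP->|XL]; first by exists w; rewrite ?mem_head.
have [|//|w' w'ws XN] := IHws (S :\ w) _ _ XL.
  move=> x xws; rewrite !inE sub ?inE ?xws ?orbT // andbT.
  by apply: contraNneq wws => <-.
exists w'; first by rewrite inE w'ws orbT.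
by apply: subset_trans XN _; apply/subsetP=> u; rewrite !inE => /andP[/andP[_ ->]].
Qed.

Lemma size_links ws S : size (links e S ws) = size ws.
Proof. by elim: ws S => //= w ws IHws S; rewrite IHws. Qed.

End Cliques.

(** * Cycle spaces of induced subgraphs *)

Section Cycles.

Import GRing.Theory.
Local Open Scope ring_scope.

Variables (K : fieldType) (V : finType) (e : rel V).
Hypotheses (e_sym : symmetric e) (e_irr : irreflexive e).
Implicit Types (S F G H : {set V}) (u v w : V) (ws : seq V).

Local Notation sign := (face_sign K).
Local Notation n := #|{: {set V}}|.

Definition coeff (c : 'rV[K]_n) (F : {set V}) : K := c 0 (enum_rank F).

Definition boundary_mx : 'M[K]_n :=
  \matrix_(i, j) incidence K (enum_val i) (enum_val j).

(** Chains are indexed by all subsets of [V], so the cycle spaces of different [S] are subspaces of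
    one space; this projection onto the remaining coordinates imposes the support. *)
Definition outside_mx (S : {set V}) (k : nat) : 'M[K]_n :=
  \matrix_(i, j) ((i == j) && (enum_val i \notin cliques e S k))%:R.

(* Row space: the chains supported on the [k]-cliques in [S] with zero boundary. *)
Definition cycle_mx (S : {set V}) (k : nat) : 'M[K]_n :=
  kermx (row_mx boundary_mx (outside_mx S k)).

Definition cycle_rank (S : {set V}) (k : nat) : nat := \rank (cycle_mx S k).

Definition link_coeff (w : V) (F G : {set V}) : K :=
  if (w \notin G) && (F == w |: G) then sign F w else 0.

Definition link_mx (w : V) : 'M[K]_n :=
  \matrix_(i, j) link_coeff w (enum_val i) (enum_val j).

Lemma sum_coeff (c : 'rV[K]_n) (f : {set V} -> K) :
  \sum_i c 0 i * f (enum_val i) = \sum_F coeff c F * f F.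
Proof.
rewrite (reindex_onto (@enum_rank {set V}) (@enum_val _ _)) /=; last first.
  by move=> i _; rewrite enum_valK.
apply: eq_big => F; first by rewrite enum_rankK eqxx.
by rewrite enum_rankK.
Qed.

Lemma coeff_boundary c H :
  coeff (c *m boundary_mx) H = \sum_(v | v \notin H) coeff c (v |: H) * sign (v |: H) v.
Proof.
rewrite /coeff mxE; under eq_bigr do rewrite mxE enum_rankK.
rewrite (sum_coeff c (fun F => incidence K F H)).
under eq_bigr do rewrite /incidence mulr_sumr.
rewrite (exchange_big_dep xpredT) //= [RHS]big_mkcond; apply: eq_bigr => v _.
case: (boolP (v \in H)) => vH /=.
  rewrite big1 // => F /andP[_ /eqP FH]; move: vH; by rewrite -FH !inE eqxx.
rewrite (big_pred1 (v |: H)) // => F /=; apply/andP/eqP => [[vF /eqP <-]|->].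
  by rewrite setD1K.
by rewrite setU11 setU1K.
Qed.

Lemma coeff_outside c S k F :
  coeff (c *m outside_mx S k) F = if F \in cliques e S k then 0 else coeff c F.
Proof.
rewrite /coeff mxE (bigD1 (enum_rank F)) //= mxE eqxx enum_rankK big1 => [|i iF].
  by case: (F \in _); rewrite ?mulr0 ?mulr1 ?addr0.
by rewrite mxE (negPf iF) mulr0.
Qed.

Lemma coeff_link c w G :
  coeff (c *m link_mx w) G = if w \in G then 0 else coeff c (w |: G) * sign (w |: G) w.
Proof.
rewrite {1}/coeff mxE; under eq_bigr do rewrite mxE enum_rankK.
rewrite (sum_coeff c (fun F => link_coeff w F G)) /link_coeff.
case: (boolP (w \in G)) => wG /=.
  by rewrite big1 // => F _; rewrite mulr0.
rewrite (bigD1 (w |: G)) //= eqxx big1 ?addr0 // => F /negPf->.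
by rewrite mulr0.
Qed.

Lemma coeff_eq0 (c : 'rV[K]_n) : (forall F, coeff c F = 0) -> c = 0.
Proof.
by move=> c0; apply/rowP => i; rewrite mxE -[i]enum_valK; apply: c0.
Qed.

Lemma coeff0 F : coeff 0 F = 0.
Proof. by rewrite /coeff mxE. Qed.

Lemma cycleP S k (c : 'rV[K]_n) :
  reflect ((forall F, F \notin cliques e S k -> coeff c F = 0) /\
           forall H, \sum_(v | v \notin H) coeff c (v |: H) * sign (v |: H) v = 0)
          (c <= cycle_mx S k)%MS.
Proof.
apply: (iffP sub_kermxP); rewrite mul_mx_row.
  move/eqP; rewrite row_mx_eq0 => /andP[/eqP bc /eqP oc]; split=> [F FS|H].
    by have := coeff_outside c S k F; rewrite oc coeff0 (negPf FS) => <-.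
  by rewrite -coeff_boundary bc coeff0.
case=> oc bc; apply/eqP; rewrite row_mx_eq0; apply/andP; split; apply/eqP/coeff_eq0 => F.
  by rewrite coeff_boundary bc.
by rewrite coeff_outside; case: ifPn => // /oc.
Qed.

Lemma sign_neq0 F v : sign F v != 0.
Proof. by rewrite /face_sign signr_eq0. Qed.

Lemma sign_swap F v w : v \in F -> w \in F -> v != w ->
  sign F v * sign (F :\ v) w = - (sign F w * sign (F :\ w) v).
Proof.
move=> vF wF vw; case: (ltngtP (enum_rank v) (enum_rank w)) => [lt|gt|/val_inj/enum_rank_inj eq].
- exact: face_sign_swap.
- by rewrite (face_sign_swap K wF vF gt) opprK.
- by rewrite eq eqxx in vw.
Qed.

Lemma cycle_rank_sub S S' k : S' \subset S -> (cycle_rank S' k <= cycle_rank S k)%N.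
Proof.
move=> SS; apply: mxrankS; apply/rV_subP => c /cycleP[oc bc]; apply/cycleP.
by split=> // F FS; apply: oc; apply: contra FS; apply/subsetP/cliques_sub.
Qed.

(** Rank-nullity for [link_mx w], which reads off the part of a chain through [w]: cycles in its
    kernel avoid [w], and it sends cycles to cycles of the link. *)
Lemma cycle_rank_link S w k : w \in S ->
  (cycle_rank S k.+1 <= cycle_rank (S :\ w) k.+1 + cycle_rank (neighbours e w S) k)%N.
Proof.
move=> wS; rewrite /cycle_rank -(mxrank_mul_ker (cycle_mx S k.+1) (link_mx w)) addnC.
apply: leq_add; apply: mxrankS.
  apply/rV_subP => c; rewrite sub_capmx => /andP[/cycleP[oc bc] /sub_kermxP lc].
  apply/cycleP; split=> // F FS; case: (boolP (F \in cliques e S k.+1)) => FS'; last exact: oc.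
  have wF : w \in F by apply: contraR FS => wF; rewrite -cliques_del inE FS'.
  have := coeff_link c w (F :\ w); rewrite lc coeff0 !inE eqxx /= setD1K //.
  by move/esym/eqP; rewrite mulf_eq0 (negPf (sign_neq0 _ _)) orbF => /eqP.
apply/row_subP => i; rewrite row_mul; set c := row i _.
have /cycleP[oc bc] : (c <= cycle_mx S k.+1)%MS by apply: row_sub.
apply/cycleP; split=> [G GN|H].
  rewrite coeff_link; case: ifPn => // wG; rewrite oc ?mul0r //.
  by apply: contra GN => GS; rewrite -(cliques_lnk e_sym e_irr) // inE wG.
case: (boolP (w \in H)) => wH.
  by rewrite big1 // => v _; rewrite coeff_link inE wH orbT mul0r.
(* The boundary condition at [w |: H], up to a sign, is the one for the link at [H], since deleting
   two vertices in either order gives opposite signs. *)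
have := bc (w |: H) => /(congr1 (fun x => - (sign (w |: H) w * x))).
rewrite mulr0 oppr0 mulr_sumr -sumrN => E; apply: etrans E.
rewrite (bigD1 w) //= coeff_link setU11 mul0r add0r.
apply: eq_big => [v|v /andP[vH vw]]; first by rewrite !inE negb_or andbC.
rewrite coeff_link !inE eq_sym (negPf vw) (negPf wH) /=.
have E : v |: (w |: H) = w |: (v |: H) by rewrite setUCA.
have F1 : (w |: (v |: H)) :\ w = v |: H by rewrite setU1K // !inE negb_or eq_sym vw.
have F2 : (w |: (v |: H)) :\ v = w |: H by rewrite -E setU1K // !inE negb_or vw.
have := @sign_swap (w |: (v |: H)) w v; rewrite F1 F2 eq_sym vw !inE !eqxx orbT /=.
move=> /(_ isT isT isT) sw; rewrite E -mulrA sw mulrN; congr (- _).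
by rewrite [RHS]mulrCA (mulrC (sign (w |: H) w)).
Qed.

(** All cliques of this size contain [v], so the boundary at [F :\ v] sees the coefficient of [F]
    alone. *)
Lemma cycle_rank_cone S v k : v \in S -> cliques e (S :\ v) k.+1 = set0 ->
  cycle_rank S k.+1 = 0%N.
Proof.
move=> vS S0; apply/eqP; rewrite mxrank_eq0 -submx0; apply/rV_subP => c /cycleP[oc bc].
have -> : c = 0; last exact: sub0mx.
apply: coeff_eq0 => F; case: (boolP (F \in cliques e S k.+1)) => FS; last exact: oc.
have del G : G \in cliques e S k.+1 -> v \in G.
  by move=> GS; apply/negPn/negP => vG; have := in_set0 G; rewrite -S0 -cliques_del inE GS vG.
have vF := del F FS; have := bc (F :\ v).
rewrite (bigD1 v) ?inE ?eqxx //= setD1K // big1 ?addr0 => [|u /andP[uF uv]].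
  by move/eqP; rewrite mulf_eq0 (negPf (sign_neq0 _ _)) orbF => /eqP.
rewrite oc ?mul0r //; apply/negP => /del; rewrite !inE eqxx /= orbF.
by rewrite eq_sym (negPf uv).
Qed.

Lemma cycle_rank_card S k : (cycle_rank S k <= 2 ^ #|V|)%N.
Proof.
have <- : #|powerset [set: V]| = (2 ^ #|V|)%N by rewrite card_powerset cardsT.
apply: leq_trans (rank_leq_row _) _; apply: subset_leq_card; apply/subsetP=> F _.
by rewrite powersetE subsetT.
Qed.

Lemma cycle_rank0 S : (cycle_rank S 0 <= 1)%N.
Proof.
pose d : 'rV[K]_n := delta_mx 0 (enum_rank (set0 : {set V})).
apply: leq_trans (rank_leq_row d); apply: mxrankS; apply/rV_subP => c /cycleP[oc _].
apply/sub_rVP; exists (coeff c set0); apply/rowP => i.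
rewrite !mxE eqxx /=; case: eqVneq => [->|ne]; first by rewrite mulr1.
rewrite mulr0 -[i]enum_valK; apply: oc; rewrite cliques0 inE.
by apply: contra ne => /eqP E; rewrite -E enum_valK.
Qed.

Lemma cycle_rank_peel ws S k : uniq ws -> {subset ws <= S} ->
  (cycle_rank S k.+1 <= cycle_rank (S :\: [set x in ws]) k.+1
     + \sum_(X <- links e S ws) cycle_rank X k)%N.
Proof.
elim: ws S => [|w ws IHws] S /=.
  rewrite big_nil addn0 => _ _; apply: cycle_rank_sub; apply/subsetP=> x.
  by rewrite !inE.
case/andP=> wws uws sub; rewrite big_cons setD_cons.
apply: leq_trans (cycle_rank_link k (sub w (mem_head w ws))) _.
rewrite [X in (_ <= _ + X)%N]addnC addnA leq_add2r; apply: IHws => // x xws.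
rewrite !inE sub ?inE ?xws ?orbT // andbT.
by apply: contraNneq wws => <-.
Qed.

End Cycles.

(** * Lower bounds for clique numbers *)

(** Pascal's rule term by term for [k <= r]; the other terms vanish with [t]. The right side is the
    bound for the [i.+1]-cliques of a cone, with and without the apex. *)
Lemma pascal_sum (t : nat -> nat) r i : (forall k, r < k -> t k = 0) ->
  \sum_(k < i.+2) 'C(r.+1 - k, i.+1 - k) * t k <=
  \sum_(k < i.+2) 'C(r - k, i.+1 - k) * t k + \sum_(k < i.+1) 'C(r - k, i - k) * t k.
Proof.
move=> t0; rewrite big_ord_recr [X in _ <= X + _]big_ord_recr /= subnn !bin0.
rewrite addnAC leq_add2r -big_split; apply: leq_sum => k _ /=.
have [kr|rk] := leqP k r; last by rewrite t0 // muln0.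
rewrite -mulnDl leq_mul2r; apply/orP; right.
by rewrite (subSn kr) subSn ?binS // -ltnS.
Qed.

Section LowerBounds.

Variables (K : fieldType) (V : finType) (e : rel V) (Q q : nat).
Hypotheses (e_sym : symmetric e) (e_irr : irreflexive e) (VQ : 2 ^ #|V| <= Q).
Implicit Types (S L X : {set V}) (C : {set 'I_q.+1}).
Local Notation N := (Q * q.+1).
Local Notation rk := (cycle_rank K e).

Let Q0 : 0 < Q. Proof. by apply: leq_trans VQ; rewrite expn_gt0. Qed.

Let qN : q < N. Proof. exact: leq_pmull. Qed.

Lemma card_family (F : {set {set V}}) : #|F| <= Q.
Proof.
apply: leq_trans VQ; have <- : #|powerset [set: V]| = 2 ^ #|V| by rewrite card_powerset cardsT.
by apply: subset_leq_card; apply/subsetP=> x _; rewrite powersetE subsetT.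
Qed.

Lemma rainbow0_card C : 0 < #|rainbow N C 0|.
Proof.
by rewrite -(below0 N C 0); apply: subset_leq_card; apply: below_rainbow.
Qed.

(** A number up to [Q] fits when [0 < k <= #|C|]; the last two hypotheses settle the cases of too
    few colours and of the empty set. *)
Lemma card_le_rainbow C m k : m <= Q -> (#|C| < k -> m = 0) -> (k = 0 -> m <= 1) ->
  m <= #|rainbow N C k|.
Proof.
move=> mQ m0 m1; case: k m0 m1 => [|k] m0 m1.
  by apply: leq_trans (m1 erefl) _; apply: rainbow0_card.
have [kC|/m0->//] := leqP k.+1 #|C|.
exact: leq_trans mQ (rainbow_card_ge _ _ kC).
Qed.

Lemma pick_vertex S (f : V -> nat) : S != set0 ->
  exists2 v, v \in S & forall w, w \in S -> f w <= f v.
Proof.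
case/set0Pn=> v0 v0S; case: (@arg_maxnP _ v0 (mem S) f v0S) => v /= vS vmax.
by exists v.
Qed.

(* Delete the non-neighbours of a vertex [v] of [S] whose link is largest; what
   is left is the link of [v], or the cone over it. *)
Theorem homology_lower_bound r S C J :
  #|C| = r -> cliques e S r.+1 = set0 -> initial (rainbow N C r) J -> #|J| <= rk S r ->
  forall i, \sum_(k < i.+1) 'C(r - k, i - k) * #|shadow k J| <= #|cliques e S i|.
Proof.
elim: r S C J => [|r IHr] S C J cC clS iJ cJ i.
  rewrite big_ord_recl big1 => [|k _]; last first.
    by case: iJ => JP _; rewrite (shadow_gt JP) ?cards0 ?muln0.
  rewrite addn0 !subn0 shadow0; case: i => [|i]; last by rewrite bin0n.
  by rewrite cliques0 cards1 bin0 mul1n leq_b1.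
have [J0|J0] := eqVneq J set0.
  rewrite big1 // => k _; rewrite J0; suff -> : shadow k (set0 : {set {set 'I_N}}) = set0.
    by rewrite cards0 muln0.
  by apply/setP=> T; rewrite [RHS]inE; apply/shadowP => -[_ [x]]; rewrite inE.
have S0 : S != set0.
  apply: contraNneq J0 => S0; rewrite -cards_eq0 -leqn0; apply: leq_trans cJ _.
  rewrite leqn0 mxrank_eq0 -submx0; apply/rV_subP => c /cycleP[oc _].
  suff -> : c = GRing.zero by apply: sub0mx.
  by apply: coeff_eq0 => F; apply: oc; rewrite S0 cliques_set0 inE.
have [j jC] : exists j, j \in C by apply/set0Pn; rewrite -card_gt0 cC.
have cC' : #|C :\ j| = r by move: cC; rewrite (cardsD1 j) jC => -[].
have [v vS vmax] := pick_vertex (fun v => rk (neighbours e v S) r) S0.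
set L := neighbours e v S; set ws := enum ((S :\: L) :\ v).
have wsS : {subset ws <= S} by move=> w; rewrite mem_enum !inE => /and3P[].
have uws : uniq ws := enum_uniq _.
have vL : v \notin L by rewrite inE e_irr andbF.
have LS : L \subset S by apply/subsetP=> u; rewrite inE => /andP[].
set S' := S :\: [set x in ws].
have S'E : S' = v |: L.
  apply/setP=> u; rewrite !inE mem_enum !inE; case: eqVneq => [->|_]; first by rewrite vS.
  by case: (u \in S); rewrite ?andbF ?andbT //= negbK.
have S'v : S' :\ v = L by rewrite S'E setU1K.
have nS' : neighbours e v S' = L.
  apply/setP=> u; rewrite S'E !inE; case: eqVneq => [->|_]; last by rewrite -andbA andbb.
  by rewrite e_irr !andbF.
have clL := cliques_neighbours e_sym e_irr vS clS.
have rkS' : rk S' r.+1 = 0.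
  by apply: (@cycle_rank_cone _ _ _ _ v); rewrite ?S'v // S'E setU11.
set bs := [seq rk X r | X <- links e S ws]; set b := rk L r; set P := rainbow N (C :\ j) r.
(* The cone over [L] carries no cycle, so the family to be glued has empty deletion. *)
have cJ' : #|J| <= #|set0 : {set {set 'I_N}}| + sumn bs.
  apply: leq_trans cJ _; apply: leq_trans (cycle_rank_peel K e_sym e_irr r uws wsS) _.
  by rewrite -/S' rkS' cards0 sumnE big_map.
have clX X : X \in links e S ws -> cliques e X r.+1 = set0.
  case/(links_sub wsS uws)=> w /wsS wS Xw; apply/eqP; rewrite -subset0.
  by rewrite -(cliques_neighbours e_sym e_irr wS clS); apply: cliques_sub.
have bsb b' : b' \in bs -> b' <= b.
  case/mapP=> X /(links_sub wsS uws)[w /wsS wS Xw] ->.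
  exact: leq_trans (cycle_rank_sub K e r Xw) (vmax w wS).
have bP : b <= #|P|.
  apply: card_le_rainbow; first exact: leq_trans (cycle_rank_card _ _ _ _) VQ.
    by rewrite cC' ltnn.
  by rewrite /b => ->; apply: cycle_rank0.
have sQ : size bs <= Q.
  rewrite size_map size_links -cardE; apply: leq_trans (max_card _) _.
  by apply: leq_trans VQ; apply: ltnW; apply: ltn_expl.
have glue k : #|shadow k.+1 J| <= #|shadow k.+1 (init P b)|
    + \sum_(b' <- bs) #|shadow k (init P b')|.
  have := shadow_glue Q0 k jC iJ (sub0set _) sQ bsb bP cJ'.
  rewrite -shadowU set0U; exact.
case: i => [|i].
  rewrite big_ord_recl big_ord0 addn0 bin0 mul1n shadow0 cliques0 cards1; exact: leq_b1.
rewrite (card_cliques_peel e_sym e_irr i uws wsS) -/S'.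
rewrite (@card_cliques_step _ _ e_sym e_irr S' v) ?S'v ?nS'; last by rewrite S'E setU11.
have IHL := IHr L (C :\ j) (init P b) cC' clL (init_initial _ _) (card_init_le _ _).
apply: leq_trans (leq_add (leq_add (IHL i.+1) (IHL i)) _); last first.
  rewrite big_seq; apply: leq_sum => X XL.
  exact: (IHr X (C :\ j) (init P (rk X r)) cC' (clX X XL) (init_initial _ _) (card_init_le _ _) i).
have t0 k : r < k -> #|shadow k (init P b)| = 0.
  by move=> rk; rewrite (shadow_gt (init_sub P b)) ?cards0.
apply: leq_trans (leq_add (pascal_sum i t0) (leqnn _)).
rewrite -big_seq exchange_big /=; under [X in _ + X]eq_bigr => k _ do rewrite -big_distrr /=.
rewrite [X in X <= _]big_ord_recl [X in _ <= X + _]big_ord_recl -addnA; apply: leq_add.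
  (* At index 0 both shadows are the empty set alone: were [b] zero, all links would have rank zero
     and [J] would be empty. *)
  rewrite leq_mul2l; apply/orP; right; rewrite !shadow0 J0.
  suff : 0 < #|init P b| by rewrite card_gt0 => ->.
  rewrite card_init // lt0n; apply: contra J0 => /eqP b0.
  rewrite -cards_eq0 -leqn0; apply: leq_trans cJ' _; rewrite cards0 add0n leqn0 sumnE.
  by rewrite big_seq big1 // => b' /bsb; rewrite b0 leqn0 => /eqP.
rewrite -big_split; apply: leq_sum => k _; rewrite !lift0 /= !subSS -mulnDr leq_mul2l.
by apply/orP; right; apply: leq_trans (glue k) _; rewrite leq_add2l big_map.
Qed.

(** Here [v] is deleted with its non-neighbours, and the cliques of the remaining [L] supply the
    deletion [I] of the glued family. By induction the shadow of [I] is a segment of size at most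
    [b], as is the largest link; being nested, they together cost no more than the [k.+1]-cliques of
    [L]. *)
Theorem clique_lower_bound r S C k J :
  #|C| = r -> cliques e S r.+1 = set0 -> initial (rainbow N C k.+1) J ->
  #|J| <= #|cliques e S k.+1| -> #|shadow k J| <= #|cliques e S k|.
Proof.
elim: r S C k J => [|r IHr] S C k J cC clS iJ cJ.
  move: cJ; rewrite (cliques_gt clS) // cards0 leqn0 cards_eq0 => /eqP->.
  rewrite (_ : shadow k set0 = set0) ?cards0 //.
  by apply/setP=> T; rewrite [RHS]inE; apply/shadowP => -[_ [x]]; rewrite inE.
case: k iJ cJ => [|k] iJ cJ.
  by rewrite shadow0 cliques0 cards1 leq_b1.
have [S0|S0] := eqVneq S set0.
  move: cJ; rewrite S0 cliques_set0 cards0 leqn0 cards_eq0 => /eqP->.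
  rewrite (_ : shadow _ set0 = set0) ?cards0 //.
  by apply/setP=> T; rewrite [RHS]inE; apply/shadowP => -[_ [x]]; rewrite inE.
have [j jC] : exists j, j \in C by apply/set0Pn; rewrite -card_gt0 cC.
have cC' : #|C :\ j| = r by move: cC; rewrite (cardsD1 j) jC => -[].
have [v vS vmax] := pick_vertex (fun v => #|cliques e (neighbours e v S) k.+1|) S0.
set L := neighbours e v S; set ws := enum (S :\: L).
have wsS : {subset ws <= S} by move=> w; rewrite mem_enum !inE => /andP[].
have uws : uniq ws := enum_uniq _.
have S'E : S :\: [set x in ws] = L.
  by apply/setP=> u; rewrite !inE mem_enum !inE; case: (u \in S); rewrite ?andbF ?andbT //= negbK.
have clL := cliques_neighbours e_sym e_irr vS clS.
have clX X : X \in links e S ws -> cliques e X r.+1 = set0.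
  case/(links_sub wsS uws)=> w /wsS wS Xw; apply/eqP; rewrite -subset0.
  by rewrite -(cliques_neighbours e_sym e_irr wS clS); apply: cliques_sub.
set P := rainbow N (C :\ j) k.+1.
set bs := [seq #|cliques e X k.+1| | X <- links e S ws]; set b := #|cliques e L k.+1|.
have bsb b' : b' \in bs -> b' <= b.
  case/mapP=> X /(links_sub wsS uws)[w /wsS wS Xw] ->.
  exact: leq_trans (subset_leq_card (cliques_sub e k.+1 Xw)) (vmax w wS).
have cL l : #|cliques e L l.+1| <= #|rainbow N (C :\ j) l.+1|.
  apply: card_le_rainbow => //; first exact: card_family.
  by rewrite cC' => rl; rewrite (cliques_gt clL) ?cards0.
have sQ : size bs <= Q.
  rewrite size_map size_links -cardE; apply: leq_trans (max_card _) _.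
  by apply: leq_trans VQ; apply: ltnW; apply: ltn_expl.
set I := init (rainbow N (C :\ j) k.+2) #|cliques e L k.+2|.
have cI : #|I| = #|cliques e L k.+2| by rewrite card_init ?cL.
have cJ' : #|J| <= #|I| + sumn bs.
  apply: leq_trans cJ _; rewrite (card_cliques_peel e_sym e_irr k.+1 uws wsS) S'E cI.
  by rewrite leq_add2l sumnE big_map.
apply: leq_trans (shadow_glue Q0 k jC iJ (init_sub _ _) sQ bsb (cL k) cJ') _.
rewrite (card_cliques_peel e_sym e_irr k uws wsS) S'E; apply: leq_add.
  apply: leq_trans (card_init_le P b); rewrite subset_leq_card // subUset; apply/andP; split.
    apply: initial_sub_init; first by apply: shadow_initial => //; apply: init_initial.
    by apply: (IHr L (C :\ j)) => //; [apply: init_initial | rewrite cI].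
  by rewrite (@shadow_id _ _ (C :\ j) k.+1) ?init_sub.
rewrite big_map big_seq [X in _ <= X]big_seq; apply: leq_sum => X XL.
apply: (IHr X (C :\ j)) => //; [exact: clX | exact: init_initial | exact: card_init_le].
Qed.

End LowerBounds.

(** * Canonical representations *)

Fixpoint shift_entries (r : nat) (ns : seq nat) : seq nat :=
  if ns is n :: ns' then n + r :: shift_entries r.-1 ns' else [::].

(** The weight ['C(r - k, i - k)] depends on differences only, so passing to the tail lowers [r],
    [k] and [i] together and [turan_number_shift] applies to each entry. *)
Lemma turan_sum_shift r i ns : size ns <= r ->
  \sum_(k < i.+1) 'C(r - k, i - k) * turan_sum r k ns = turan_sum r i (shift_entries r ns).
Proof.
elim: ns r i => [|n ns IHns] r i /=.
  by move=> _; rewrite big1 // => k _; rewrite muln0.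
case: r => [//|r]; rewrite ltnS => sr.
under eq_bigr => k _ do rewrite mulnDr.
rewrite big_split /= turan_number_shift; congr (_ + _).
rewrite big_ord_recl muln0 add0n; case: i => [|i]; first by rewrite big_ord0.
by rewrite -IHns //; apply: eq_bigr => k _; rewrite lift0 !subSS.
Qed.

Lemma turan_number_gt r n k : r < k -> turan_number r n k = 0.
Proof.
case: r => [|r] rk; first by case: k rk.
have := @turan_number_below n r setT n k (leqnn n); rewrite cardsT card_ord count_below_setT // => <-.
apply: eq_card0 => x; apply/negbTE/negP => /(subsetP (below_rainbow _ _ _ _))/rainbow_le.
by rewrite cardsT card_ord leqNgt rk.
Qed.

Lemma turan_sum_gt r k ns : size ns <= r -> r < k -> turan_sum r k ns = 0.
Proof.
elim: ns r k => [//|n ns IHns] [//|r] [//|k] /= sr rk.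
by rewrite turan_number_gt // IHns.
Qed.

Lemma turan_sum_iota (n : nat -> nat) r k i m :
  turan_sum r k [seq n j | j <- iota i m] =
  \sum_(j < m) (if j <= k then turan_number (r - j) (n (i + j)) (k - j) else 0).
Proof.
elim: m i r k => [|m IHm] i r k; first by rewrite big_ord0.
rewrite big_ord_recl /= !subn0 addn0; congr (_ + _).
case: k => [|k]; first by rewrite big1.
rewrite IHm; apply: eq_bigr => j _; rewrite /bump leq0n add1n ltnS subSS addSnnS.
by case: r => [|r]; rewrite ?subSS // !sub0n.
Qed.

Lemma canonical_iota (n : nat -> nat) r K s i : i <= s -> s < K -> K <= r ->
  (forall j, j <= s -> K - j <= n j) ->
  (forall j, j < s -> n j.+1 < n j - n j %/ (r - j)) ->
  canonical (r - i) (K - i) [seq n j | j <- iota i (s - i).+1].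
Proof.
move=> le_is sK Kr nK nd; move Em: (s - i) => m; elim: m i le_is Em => [|m IHm] i le_is Em.
  by rewrite /= subn_gt0 (leq_ltn_trans le_is sK) leq_sub2r // nK.
have lt_is : i < s by rewrite -subn_gt0 Em.
have := IHm i.+1 lt_is; rewrite subnS Em => /(_ erefl).
rewrite [iota i _]/= [iota i.+1 _]/= => can.
apply/and4P; split; rewrite ?subn_gt0 ?(ltn_trans lt_is sK) ?leq_sub2r ?nK //.
by apply/andP; split; [exact: nd | move: can; rewrite !subnS].
Qed.

Lemma turan_cliques_gt r n k : n < k -> turan_cliques r n k = 0.
Proof.
move=> nk; apply: eq_card0 => S; rewrite inE; apply/negbTE; rewrite negb_and.
apply/orP; left; apply: contraTneq nk => <-; rewrite -leqNgt.
by apply: leq_trans (max_card _) _; rewrite card_ord.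
Qed.

Section Integers.

Import Order.TTheory GRing.Theory Num.Theory.
Local Open Scope ring_scope.

Lemma turan_binomialE r (n i j : nat) : (0 < r)%N ->
  turan_binomial r n%:Z (i%:Z - j%:Z) = if (j <= i)%N then turan_number r n (i - j) else 0%N.
Proof.
case: r => [//|r] _; rewrite /turan_binomial /turan_number subr_ge0 lez_nat.
case: leqP => //= ji; rewrite subzn // lez_nat !absz_nat.
by case: leqP => // /turan_cliques_gt->.
Qed.

Lemma le_divz_neg (x : int) (m : nat) : (0 < m)%N -> x < 0 -> x <= (x %/ m%:Z)%Z.
Proof.
move=> m0 x0; have := divz_eq x m; have := ltz_pmod x (d := m).
have := modz_ge0 x (d := m); rewrite ltz_nat m0.
have -> : (m%:Z != 0) by rewrite eqz_nat -lt0n.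
move=> /(_ isT) r0 /(_ isT) rm xE; set y := (x %/ m)%Z in xE *; set z := (x %% m)%Z in r0 rm xE.
nia.
Qed.

(** Induction from the last entry upwards. A negative entry [x] is impossible: division rounds down,
    so [x] minus its quotient would be at most 0 and could not exceed the next entry, already known
    to be nonnegative. *)
Lemma canonical_entries (d a s : nat) (c : nat -> int) :
  canonical_representation d d a s c -> forall i : nat, (i <= s)%N -> (d - i)%N%:Z <= c (d - i)%N.
Proof.
case=> _ _ step last sd i; move Em: (s - i)%N => m; elim: m i Em => [|m IHm] i Em le_is.
  by have -> : i = s by apply/eqP; rewrite eqn_leq le_is -subn_eq0 Em.
have lt_is : (i < s)%N by rewrite -subn_gt0 Em.
have := step i lt_is; rewrite -subnDA addn1.
have := IHm i.+1; rewrite subnS Em => /(_ erefl lt_is).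
set x := c (d - i)%N; set y := c _; have d0 : (0 < d - i)%N by rewrite subn_gt0 (ltn_trans lt_is).
case: (ltrP x 0) => x0.
  by have := le_divz_neg d0 x0; set z := (x %/ _)%Z; move: d0; lia.
have : (0 <= (x %/ (d - i)%N)%Z) by rewrite divz_ge0 // ltz_nat.
set z := (x %/ _)%Z; move: d0; lia.
Qed.

End Integers.

Section CanonicalEntries.

Variables (d a s : nat) (c : nat -> int).
Hypothesis crep : canonical_representation d d a s c.

Definition entry (j : nat) : nat := absz (c (d - j)).

Lemma s_lt_d : s < d. Proof. by case: crep. Qed.

Lemma entryE j : j <= s -> c (d - j) = (entry j)%:Z%R.
Proof.
move=> js; have := canonical_entries crep js; rewrite /entry.
by case: (c (d - j)).
Qed.

Lemma entry_ge j : j <= s -> d - j <= entry j.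
Proof. by move=> js; have := canonical_entries crep js; rewrite entryE. Qed.

Lemma entry_step j : j < s -> entry j.+1 < entry j - entry j %/ (d - j).
Proof.
move=> js; case: crep => _ _ /(_ j js) + _ _.
rewrite -subnDA addn1 !entryE // ?(ltnW js) // divz_nat.
have := leq_div (entry j) (d - j); set y := _ %/ _; set z := entry _; lia.
Qed.

Lemma entries_sum : turan_sum d d [seq entry j | j <- iota 0 s.+1] = a.
Proof.
case: crep => _ -> _ _ sd; rewrite turan_sum_iota; apply: eq_bigr => -[j js] _ /=.
have jd : j < d := leq_ltn_trans (js : j <= s) sd.
rewrite add0n entryE // -[(d - j)%:Z%R]GRing.subr0 turan_binomialE ?subn_gt0 //.
by rewrite subn0 (ltnW jd).
Qed.

Lemma shifted_sumE i : shifted_sum d s c i%:Z%R =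
  turan_sum d i [seq entry j + (d - j) | j <- iota 0 s.+1].
Proof.
rewrite turan_sum_iota; apply: eq_bigr => -[j js] _ /=; rewrite add0n entryE //.
by rewrite -PoszD turan_binomialE // subn_gt0 (leq_ltn_trans _ s_lt_d).
Qed.

Lemma shift_entries_iota i m :
  shift_entries (d - i) [seq entry j | j <- iota i m] =
  [seq entry j + (d - j) | j <- iota i m].
Proof. by elim: m i => //= m IHm i; rewrite -subnS IHm. Qed.

Lemma entries_canonical : canonical d d [seq entry j | j <- iota 0 s.+1].
Proof.
have := @canonical_iota entry d d s 0 (leq0n _) s_lt_d (leqnn d) entry_ge entry_step.
by rewrite !subn0.
Qed.

(* Appending the least possible entry [i - s] to the shifted canonical sequence
   adds exactly one [i.+1]-set. *)
Definition next_entry (i j : nat) : nat := if j <= s then entry j + (d - j) else i - s.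

Lemma next_canonical i : s < i < d ->
  canonical d i.+1 [seq next_entry i j | j <- iota 0 s.+2].
Proof.
case/andP=> si id; have := @canonical_iota (next_entry i) d i.+1 s.+1 0 (leq0n _).
rewrite !subn0; apply=> // [j|j].
  rewrite leq_eqVlt /next_entry => /orP[/eqP->|js]; first by rewrite ltnn subSS.
  rewrite -[j <= s]ltnS js; apply: leq_trans (leq_addl _ _).
  by rewrite leq_sub2r.
rewrite ltnS leq_eqVlt /next_entry => /orP[/eqP->|js].
  (* Here [d - s >= 2], so the old last entry exceeds its quotient. After the shift, at least
     [d - s] remains once the quotient is removed, more than the appended [i - s]. *)
  rewrite ltnn leqnn; have := entry_ge (leqnn s).
  have e2 : 1 < d - s by lia.
  rewrite divnDr ?dvdnn // divnn (ltnW e2) => es.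
  have : entry s %/ (d - s) < entry s by apply: ltn_Pdiv => //; lia.
  set y := _ %/ _; lia.
rewrite js (ltnW js) divnDr ?dvdnn // divnn.
have dj : 0 < d - j by have := s_lt_d; lia.
have := entry_step js; set y := _ %/ _; rewrite dj; lia.
Qed.

Lemma next_sum i k : k <= i.+1 -> s < k ->
  turan_sum d k [seq next_entry i j | j <- iota 0 s.+2] =
  turan_sum d k [seq entry j + (d - j) | j <- iota 0 s.+1]
    + turan_number (d - s.+1) (i - s) (k - s.+1).
Proof.
move=> ki sk; rewrite !turan_sum_iota big_ord_recr /= add0n sk /next_entry ltnn; congr (_ + _).
by apply: eq_bigr => -[j js] _ /=; rewrite add0n -[j <= s]ltnS js.
Qed.

End CanonicalEntries.

(** * Flag complexes as clique complexes *)

Section Flag.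

Import GRing.Theory.
Local Open Scope ring_scope.

Variables (K : fieldType) (V : finType) (D : {set {set V}}).
Hypothesis flagD : flag_complex D.
Implicit Types (F G H : {set V}) (u v : V).

Definition vertices : {set V} := [set v | [set v] \in D].

Definition adjacent : rel V := fun u v => (u != v) && ([set u; v] \in D).

Lemma adjacent_sym : symmetric adjacent.
Proof. by move=> u v; rewrite /adjacent eq_sym setUC. Qed.

Lemma adjacent_irr : irreflexive adjacent.
Proof. by move=> u; rewrite /adjacent eqxx. Qed.

Lemma complex_closed F G : F \in D -> G \subset F -> G \in D.
Proof.
case/andP: flagD => /andP[_ /forall_inP cl] _ FD GF.
by have /forallP/(_ G)/implyP := cl F FD; apply.
Qed.

Lemma faceE F : (F \in D) = (F \subset vertices) && clique adjacent F.
Proof.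
apply/idP/andP => [FD|[FS /cliqueP cl]].
  split.
    by apply/subsetP=> v vF; rewrite inE (complex_closed FD) // sub1set.
  apply/cliqueP => u v uF vF uv; rewrite /adjacent uv (complex_closed FD) //.
  by rewrite subUset !sub1set uF.
case/andP: flagD => _ /forallP/(_ F)/implyP; apply; apply/andP; split.
  by apply/forall_inP => v /(subsetP FS); rewrite inE.
apply/forall_inP => u uF; apply/forall_inP => v vF; apply/implyP => uv.
by have /andP[] := cl u v uF vF uv.
Qed.

Lemma facesE (i : nat) : faces D (i%:Z - 1) = cliques adjacent vertices i.
Proof. by apply/setP=> F; rewrite !inE subrK eqz_nat faceE andbAC -andbA [X in _ && X]andbC. Qed.

Lemma face_numberE (i : nat) : face_number D (i%:Z - 1) = #|cliques adjacent vertices i|.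
Proof. by rewrite /face_number facesE. Qed.

Lemma cliques_above_dimension (d : nat) : dimension D = d%:Z - 1 ->
  cliques adjacent vertices d.+1 = set0.
Proof.
rewrite /dimension => /addIr[max]; apply/setP=> F; rewrite [RHS]inE; apply/cliquesP => -[FS cF cl].
have FD : F \in D by rewrite faceE FS.
have : (#|F| <= \max_(G in D) #|G|)%N by rewrite (bigD1 F) //= leq_maxl.
by rewrite max cF ltnn.
Qed.

(** Only this direction is needed, so the boundaries are dropped. The row-free matrix [E] extends
    chains by zero to all subsets of [V] without changing the rank. *)
Lemma betti_le (d : nat) : (betti K D (d%:Z - 1) <= cycle_rank K adjacent vertices d)%N.
Proof.
rewrite /betti; apply: leq_trans (leq_subr _ _) _; rewrite /cycles.
set A := faces D (d%:Z - 1); set B := faces D _; set Z := kermx _.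
pose E : 'M[K]_(#|A|, #|{: {set V}}|) := \matrix_(i, j) (enum_val i == enum_val j)%:R.
have freeE : row_free E.
  apply/row_freeP; exists E^T; apply/matrixP => i j; rewrite !mxE.
  rewrite (bigD1 (enum_rank (enum_val i))) //= !mxE enum_rankK eqxx mul1r.
  rewrite big1 => [|l li]; last first.
    rewrite !mxE; case: eqP => [il|]; last by rewrite mul0r.
    by rewrite il enum_valK eqxx in li.
  by rewrite addr0 (inj_eq enum_val_inj) eq_sym.
rewrite -(mxrankMfree Z freeE); apply: mxrankS; apply/row_subP => i0; rewrite row_mul.
have : (row i0 Z <= Z)%MS := row_sub _ _; move: (row i0 Z) => c /sub_kermxP cB.
apply/cycleP; split=> [F FS|H].
  rewrite /coeff mxE big1 // => i _; rewrite mxE enum_rankK; case: eqP => [iF|]; last by rewrite mulr0.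
  by case/negP: FS; rewrite -facesE -iF enum_valP.
rewrite -coeff_boundary -mulmxA /coeff mxE.
have EB i : (E *m boundary_mx K V) i (enum_rank H) = incidence K (enum_val i) H.
  rewrite mxE (bigD1 (enum_rank (enum_val i))) //= !mxE !enum_rankK eqxx mul1r big1 ?addr0 // => l li.
  rewrite !mxE; case: eqP => [il|]; last by rewrite mul0r.
  by rewrite il enum_valK eqxx in li.
under eq_bigr do rewrite EB.
case: (boolP (H \in B)) => HB.
  have := congr1 (fun M : 'M_(_, _) => M 0 (enum_rank_in HB H)) cB; rewrite !mxE => Ec; apply: etrans Ec.
  by apply: eq_bigr => i _; rewrite mxE enum_rankK_in.
rewrite big1 // => i _; rewrite /incidence big_pred0 ?mulr0 // => v.
apply/negbTE/negP => /andP[vF /eqP FH]; case/negP: HB; have := enum_valP i.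
rewrite !inE -FH => /andP[FD /eqP cF]; rewrite (complex_closed FD) ?subD1set //=.
by move: cF; rewrite !subrK (cardsD1 v) vF PoszD => <-; rewrite addrAC subrr add0r.
Qed.

End Flag.

Import Order.TTheory GRing.Theory Num.Theory.
Local Open Scope ring_scope.

Theorem theorem1p3 (K : fieldType) (V : finType) (D : {set {set V}})
    (d a s : nat) (c : nat -> int) :
  flag_complex D ->
  dimension D = d%:Z - 1 ->
  betti K D (d%:Z - 1) = a ->
  (0 < a)%N ->
  canonical_representation d d a s c ->
  (forall i : nat, (shifted_sum d s c i%:Z <= face_number D (i%:Z - 1))%N) /\
  (forall k : nat, (s + 1 <= k)%N ->
     face_number D (k%:Z - 1) = shifted_sum d s c k%:Z ->
     forall i : nat, (k <= i)%N ->
       face_number D (i%:Z - 1) = shifted_sum d s c i%:Z).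
Proof.
move=> flagD dimD bettiD a0 crep; have sd := s_lt_d crep.
set e := adjacent D; set S := vertices D.
have e_sym : symmetric e := @adjacent_sym V D.
have e_irr : irreflexive e := @adjacent_irr V D.
have clS : cliques e S d.+1 = set0 := cliques_above_dimension flagD dimD.
have fE i : face_number D (i%:Z - 1) = #|cliques e S i| := face_numberE flagD i.
case: d => [//|q] in dimD bettiD crep sd clS *.
have cT : #|[set: 'I_q.+1]| = q.+1 by rewrite cardsT card_ord.
have seg ns k : canonical q.+1 k ns -> exists Q, [/\ (2 ^ #|V| <= Q)%N, (0 < Q)%N &
    exists J, [/\ initial (rainbow (Q * q.+1) [set: 'I_q.+1] k) J,
      #|J| = turan_sum q.+1 k ns &
      forall l, (l <= k)%N -> (turan_sum q.+1 l ns <= #|shadow l J|)%N]].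
  (* [2 ^ #|V|] bounds all clique counts and cycle ranks; the first entry is added so that the
     ambient vertices outnumber it, as [canonical_segment] requires. *)
  move=> can; pose Q := (2 ^ #|V| + head 0%N ns).+1; exists Q; split=> //.
    by rewrite /Q -addnS leq_addr.
  have qN : (q < Q * q.+1)%N by apply: leq_pmull.
  have [||J [iJ cJ shJ _]] := @canonical_segment _ _ qN ns [set: 'I_q.+1] k; rewrite ?cT //.
    rewrite count_below_setT //; apply: leq_trans (leq_pmulr _ _) => //.
    by rewrite /Q ltnS leq_addl.
  by exists J; rewrite cT in cJ shJ.
have lower i : (shifted_sum q.+1 s c i%:Z <= face_number D (i%:Z - 1))%N.
  have [Q [VQ Q0 [J [iJ cJ shJ]]]] := seg _ _ (entries_canonical crep).
  rewrite (entries_sum crep) in cJ.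
  have Jb : (#|J| <= cycle_rank K e S q.+1)%N by rewrite cJ -bettiD betti_le.
  rewrite fE (shifted_sumE crep).
  have := shift_entries_iota q.+1 c 0 s.+1; rewrite subn0 => <-.
  rewrite -turan_sum_shift; last by rewrite size_map size_iota.
  apply: leq_trans (homology_lower_bound e_sym e_irr VQ cT clS iJ Jb i).
  apply: leq_sum => k _; rewrite leq_mul2l; apply/orP; right.
  have [kq|qk] := leqP k q.+1; first exact: shJ.
  by rewrite turan_sum_gt // size_map size_iota.
split=> // k sk fk i; elim: i => [|i IHi].
  by rewrite leqn0 => /eqP k0; rewrite k0 addn1 in sk.
rewrite leq_eqVlt => /orP[/eqP <- //|]; rewrite ltnS => ki.
(* Equality passes from [i] to [i + 1]: a surplus clique on [i + 1] vertices is played against the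
   representation prolonged by the entry [i - s]. *)
have fi := IHi ki; apply/eqP; rewrite eqn_leq lower andbT leqNgt; apply/negP => lt.
have si : (s < i)%N by apply: leq_trans ki; rewrite -addn1.
have [id|di] := ltnP i q.+1; last first.
  by move: lt; rewrite fE (cliques_gt clS) ?cards0 // ltnS.
have [Q [VQ Q0 [J [iJ cJ shJ]]]] := seg _ _ (next_canonical crep (introT andP (conj si id))).
(* The appended entry does not exceed the number of parts because [i < d], so its Turan graph is
   complete. *)
have tn l : turan_number (q.+1 - s.+1) (i - s) l = 'C(i - s, l).
  by apply: turan_number_complete; rewrite subSS leq_sub2r.
have E := shifted_sumE crep.
have cJ' : #|J| = (shifted_sum q.+1 s c i.+1%:Z).+1.
  by rewrite cJ next_sum ?ltnS ?(ltnW si) // tn subSS binn E addn1.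
have /(clique_lower_bound e_sym e_irr VQ cT clS iJ) : (#|J| <= #|cliques e S i.+1|)%N.
  by rewrite cJ' -fE.
rewrite -fE fi leqNgt => /negP; apply.
(* The appended entry contributes ['C(i - s, i - s.+1)], which is positive, so the shadow exceeds
   the number of [i]-cliques. *)
apply: leq_trans (shJ i (leqnSn i)); rewrite next_sum // tn E -addn1 leq_add2l.
by rewrite bin_gt0 leq_sub2l.
Qed.
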